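(* Let $f:X\longrightarrow Y$ be a weak S-homotopy equivalence of flows. Then $H_n^-(f):H_n^-(X)\longrightarrow H_n^-(Y)$ is an isomorphism for every $n\geq 0$.
   Context: $\mathbf{Top}$ is the category of compactly generated topological spaces (weak Hausdorff $k$-spaces). A flow $X$ consists of a compactly generated space $\mathbb{P}X$ (the path space), a discrete space $X^0$ (the set of states), continuous maps $s,t:\mathbb{P}X\to X^0$, and a continuous associative map $*:\{(x,y)\in\mathbb{P}X\times\mathbb{P}X;\ t(x)=s(y)\}\to\mathbb{P}X$ with $s(x*y)=s(x)$ and $t(x*y)=t(y)$. A morphism of flows $f:X\to Y$ consists of a set map $f^0:X^0\to Y^0$ and a continuous map $\mathbb{P}f:\mathbb{P}X\to\mathbb{P}Y$ compatible with $s$, $t$ and $*$. The category of flows is $\mathbf{Flow}$. It carries a unique model structure such that: the weak equivalences are the weak S-homotopy equivalences, i.e. the morphisms $f$ with $f^0$ a bijection and $\mathbb{P}f$ a weak homotopy equivalence; the fibrations are the morphisms $f$ with $\mathbb{P}f$ a Serre fibration. (This model structure may be taken as known.) $Q$ denotes its cofibrant replacement functor: $\varnothing\to X$ factors functorially as a cofibration $\varnothing\to Q(X)$ followed by a trivial fibration $Q(X)\to X$; the latter is a bijection on states, so $Q(X)^0$ is identified with $X^0$. The branching space $\mathbb{P}^-X$ of a flow $X$ is the compactly generated space equipped with a continuous map $h^-:\mathbb{P}X\to\mathbb{P}^-X$ that is universal among continuous maps $\phi$ from $\mathbb{P}X$ to compactly generated spaces with $\phi(x)=\phi(x*y)$ whenever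 $t(x)=s(y)$. The homotopy branching space is $\mathrm{ho}\mathbb{P}^-X:=\mathbb{P}^-Q(X)$. The source map induces a map $s:\mathrm{ho}\mathbb{P}^-X\to X^0$. Branching homology: let $\mathcal{N}^-_*(X)$ be the augmented simplicial set with $\mathcal{N}^-_n(X)=\mathrm{Sing}_n(\mathrm{ho}\mathbb{P}^-X)$ for $n\geq 0$ (singular simplicial set), $\mathcal{N}^-_{-1}(X)=X^0$, and augmentation $\epsilon:\mathrm{Sing}_0(\mathrm{ho}\mathbb{P}^-X)\to X^0$ induced by $\gamma\mapsto s(\gamma)$. Then $H^-_{n+1}(X)$ is the $n$-th homology group of $\mathcal{N}^-_*(X)$ (integer coefficients) for $n\geq -1$; that is, $H^-_{n+1}(X)=H_n(\mathrm{ho}\mathbb{P}^-X)$ for $n\geq 1$, $H^-_1(X)=\ker(\epsilon)/\operatorname{im}(\partial:\mathbb{Z}\mathcal{N}^-_1(X)\to\mathbb{Z}\mathcal{N}^-_0(X))$ and $H_0^-(X)=\mathbb{Z}(X^0)/\operatorname{im}(\epsilon)$, where $\epsilon$ is extended linearly. These are functorial in $X$. *)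

(* Defs.v *)
From HB Require Import structures.
From mathcomp Require Import all_boot all_order all_algebra.
From mathcomp Require Import all_classical all_reals.
From mathcomp Require Import topology normedtype.
From mathcomp Require Import ring_quotient.
From mathcomp Require Import freeg.

Set Implicit Arguments.
Unset Strict Implicit.
Unset Printing Implicit Defensive.

Import Order.TTheory GRing.Theory Num.Theory.
Import numFieldNormedType.Exports.

Local Open Scope classical_set_scope.
Local Open Scope ring_scope.

Definition compact_hausdorff (K : topologicalType) : Prop :=
  compact [set: K] /\ hausdorff_space K.

(* Probing by maps from compact Hausdorff spaces determines the k-topology:
   [X] is a k-space when its open sets are exactly the k-open ones, and
   [kification X] is the set [X] with the k-open sets as its topology. *)
Definition k_open (X : topologicalType) (A : set X) : Prop :=
  forall (K : topologicalType) (u : continuousType K X),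
    compact_hausdorff K -> open (u @^-1` A).

Definition k_space (X : topologicalType) : Prop :=
  forall A : set X, k_open A -> open A.

Definition weak_hausdorff (X : topologicalType) : Prop :=
  forall (K : topologicalType) (u : continuousType K X),
    compact_hausdorff K -> closed (range u).

Record cgspace := CGSpace {
  cg_top :> topologicalType;
  cg_weak_hausdorff : weak_hausdorff cg_top;
  cg_k_space : k_space cg_top
}.

Definition kification (X : topologicalType) : Type := X.

Section Kification.
Variable X : topologicalType.

HB.instance Definition _ := Choice.on (kification X).

Let k_openT : k_open [set: X].
Proof. by move=> K u _; rewrite preimage_setT; exact: openT. Qed.

Let k_openI (A B : set X) : k_open A -> k_open B -> k_open (A `&` B).
Proof.
by move=> oA oB K u cK; rewrite preimage_setI; apply: openI;
  [exact: oA | exact: oB].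
Qed.

Let k_open_bigcup (I : Type) (f : I -> set X) :
  (forall i, k_open (f i)) -> k_open (\bigcup_i f i).
Proof.
move=> of_ K u cK; rewrite preimage_bigcup.
by apply: bigcup_open => i _; exact: of_.
Qed.

HB.instance Definition _ :=
  @isOpenTopological.Build (kification X) (@k_open X)
    k_openT k_openI k_open_bigcup.

End Kification.

Lemma k_closed (X : cgspace) (A : set X) :
  (forall (K : topologicalType) (u : continuousType K X),
    compact_hausdorff K -> closed (u @^-1` A)) -> closed A.
Proof.
move=> clA; rewrite -[A]setCK closedC; apply: cg_k_space => K u cK.
by rewrite preimage_setC openC; exact: clA.
Qed.

Section DiscreteCG.
Variable T : discreteTopologicalType.

Let discrete_wh : weak_hausdorff T.
Proof. by move=> K u _; exact: discrete_closed. Qed.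

Let discrete_k : k_space T.
Proof. by move=> A _; exact: discrete_open. Qed.

Definition discrete_cg : cgspace := CGSpace discrete_wh discrete_k.

End DiscreteCG.

Record category := Category {
  obj :> Type;
  hom : obj -> obj -> Type;
  idm : forall X, hom X X;
  cmp : forall X Y Z, hom Y Z -> hom X Y -> hom X Z;
  cmp1m : forall X Y (f : hom X Y), cmp (idm Y) f = f;
  cmpm1 : forall X Y (f : hom X Y), cmp f (idm X) = f;
  cmpA : forall X Y Z T (h : hom Z T) (g : hom Y Z) (f : hom X Y),
    cmp h (cmp g f) = cmp (cmp h g) f
}.
Arguments idm {c} X.
Arguments cmp {c X Y Z} g f.

Record initial_object (C : category) := InitialObject {
  init_obj :> C;
  init_map : forall X : C, hom init_obj X;
  init_uniq : forall (X : C) (f g : hom init_obj X), f = g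
}.

Section ModelCategory.
Variable C : category.

Definition morphism_class := forall X Y : C, hom X Y -> Prop.

Definition two_out_of_three (W : morphism_class) : Prop :=
  forall (X Y Z : C) (f : hom X Y) (g : hom Y Z),
  [/\ W _ _ f -> W _ _ g -> W _ _ (cmp g f),
      W _ _ f -> W _ _ (cmp g f) -> W _ _ g
    & W _ _ g -> W _ _ (cmp g f) -> W _ _ f].

Definition is_retract (X Y X' Y' : C) (f : hom X Y) (g : hom X' Y') : Prop :=
  exists (i : hom X X') (r : hom X' X) (j : hom Y Y') (q : hom Y' Y),
  [/\ cmp r i = idm X, cmp q j = idm Y, cmp g i = cmp j f
    & cmp f r = cmp q g].

Definition closed_under_retracts (W : morphism_class) : Prop :=
  forall (X Y X' Y' : C) (f : hom X Y) (g : hom X' Y'),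
    is_retract f g -> W _ _ g -> W _ _ f.

Definition has_lifting (A B X Y : C) (i : hom A B) (p : hom X Y) : Prop :=
  forall (a : hom A X) (b : hom B Y), cmp p a = cmp b i ->
  exists l : hom B X, cmp l i = a /\ cmp p l = b.

Record functorial_factorization := FunctorialFactorization {
  ff_mid : forall X Y : C, hom X Y -> C;
  ff_left : forall (X Y : C) (f : hom X Y), hom X (ff_mid f);
  ff_right : forall (X Y : C) (f : hom X Y), hom (ff_mid f) Y;
  ff_fact : forall (X Y : C) (f : hom X Y), cmp (ff_right f) (ff_left f) = f;
  ff_map : forall (X Y X' Y' : C) (f : hom X Y) (f' : hom X' Y')
    (a : hom X X') (b : hom Y Y'), cmp b f = cmp f' a ->
    hom (ff_mid f) (ff_mid f');
  ff_map_left : forall (X Y X' Y' : C) (f : hom X Y) (f' : hom X' Y')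
    (a : hom X X') (b : hom Y Y') (e : cmp b f = cmp f' a),
    cmp (ff_map e) (ff_left f) = cmp (ff_left f') a;
  ff_map_right : forall (X Y X' Y' : C) (f : hom X Y) (f' : hom X' Y')
    (a : hom X X') (b : hom Y Y') (e : cmp b f = cmp f' a),
    cmp (ff_right f') (ff_map e) = cmp b (ff_right f);
  ff_map_id : forall (X Y : C) (f : hom X Y)
    (e : cmp (idm Y) f = cmp f (idm X)), ff_map e = idm (ff_mid f);
  ff_map_cmp : forall (X Y X' Y' X'' Y'' : C)
    (f : hom X Y) (f' : hom X' Y') (f'' : hom X'' Y'')
    (a : hom X X') (b : hom Y Y') (a' : hom X' X'') (b' : hom Y' Y'')
    (e : cmp b f = cmp f' a) (e' : cmp b' f' = cmp f'' a')
    (e'' : cmp (cmp b' b) f = cmp f'' (cmp a' a)),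
    ff_map e'' = cmp (ff_map e') (ff_map e)
}.

Record model_structure := ModelStructure {
  weq : morphism_class;
  cof : morphism_class;
  fib : morphism_class;
  weq_2of3 : two_out_of_three weq;
  weq_retract : closed_under_retracts weq;
  cof_retract : closed_under_retracts cof;
  fib_retract : closed_under_retracts fib;
  cof_tfib_lift : forall (A B X Y : C) (i : hom A B) (p : hom X Y),
    cof i -> fib p -> weq p -> has_lifting i p;
  tcof_fib_lift : forall (A B X Y : C) (i : hom A B) (p : hom X Y),
    cof i -> weq i -> fib p -> has_lifting i p;
  cof_tfib : functorial_factorization;
  cof_tfib_left : forall (X Y : C) (f : hom X Y), cof (ff_left cof_tfib f);
  cof_tfib_right : forall (X Y : C) (f : hom X Y),
    fib (ff_right cof_tfib f) /\ weq (ff_right cof_tfib f);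
  tcof_fib : functorial_factorization;
  tcof_fib_left : forall (X Y : C) (f : hom X Y),
    cof (ff_left tcof_fib f) /\ weq (ff_left tcof_fib f);
  tcof_fib_right : forall (X Y : C) (f : hom X Y), fib (ff_right tcof_fib f)
}.

Section CofibrantReplacement.
Variables (M : model_structure) (O : initial_object C).

Definition cofrep (X : C) : C := ff_mid (cof_tfib M) (init_map O X).

Definition cofrep_proj (X : C) : hom (cofrep X) X :=
  ff_right (cof_tfib M) (init_map O X).

Let init_square (X Y : C) (f : hom X Y) :
  cmp f (init_map O X) = cmp (init_map O Y) (idm O).
Proof. exact: init_uniq. Qed.

Definition cofrep_map (X Y : C) (f : hom X Y) : hom (cofrep X) (cofrep Y) :=
  ff_map (cof_tfib M) (init_square f).

Lemma cofrep_proj_natural (X Y : C) (f : hom X Y) :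
  cmp (cofrep_proj Y) (cofrep_map f) = cmp f (cofrep_proj X).
Proof. exact: ff_map_right. Qed.

End CofibrantReplacement.

End ModelCategory.

Definition composable (S : Type) (P : topologicalType) (s t : P -> S) :
  set (P * P) := [set xy | t xy.1 = s xy.2].

(* Products in the category of compactly generated spaces are k-ifications of
   the usual ones; hence so is the topology on pairs of composable paths. *)
Record flow := Flow {
  states : discreteTopologicalType;
  paths : cgspace;
  src : continuousType paths states;
  tgt : continuousType paths states;
  star : forall x y : paths, tgt x = src y -> paths;
  star_continuous : continuous
    (fun p : kification (composable src tgt) => star (set_valP p) : paths);
  src_star : forall (x y : paths) (e : tgt x = src y), src (star e) = src x;
  tgt_star : forall (x y : paths) (e : tgt x = src y), tgt (star e) = tgt y;
  starA : forall (x y z : paths) (exy : tgt x = src y) (eyz : tgt y = src z)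
    (exyz : tgt (star exy) = src z) (exyz' : tgt x = src (star eyz)),
    star exyz = star exyz'
}.
Arguments star {f x y} e.

Record flow_hom (X Y : flow) := FlowHom {
  on_states : states X -> states Y;
  on_paths : continuousType (paths X) (paths Y);
  hom_src : forall x, src Y (on_paths x) = on_states (src X x);
  hom_tgt : forall x, tgt Y (on_paths x) = on_states (tgt X x);
  hom_star : forall (x y : paths X) (e : tgt X x = src X y)
    (e' : tgt Y (on_paths x) = src Y (on_paths y)),
    on_paths (star e) = star e'
}.

Lemma flow_homP (X Y : flow) (f g : flow_hom X Y) :
  on_states f =1 on_states g -> on_paths f =1 on_paths g -> f = g.
Proof.
case: f g => [f0 f1 fs ft fc] [g0 g1 gs gt gc] /= /funext e0 /continuousEP e1.
by case: _ / e0 in gs gt *; case: _ / e1 in gs gt gc *;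
  congr FlowHom; exact: Prop_irrelevance.
Qed.

Lemma star_eq (X : flow) (x x' y y' : paths X) (e : tgt X x = src X y)
  (e' : tgt X x' = src X y') : x = x' -> y = y' -> star e = star e'.
Proof.
by move=> xx' yy'; subst x' y'; congr star; exact: Prop_irrelevance.
Qed.

Definition flow_id (X : flow) : flow_hom X X.
Proof.
refine (@FlowHom X X idfun idfun _ _ _) => // x y e e' /=; exact: star_eq.
Defined.

Definition flow_comp (X Y Z : flow) (g : flow_hom Y Z) (f : flow_hom X Y) :
  flow_hom X Z.
Proof.
refine (@FlowHom X Z (on_states g \o on_states f) (on_paths g \o on_paths f)
  _ _ _) => [x|x|x y e e'] /=.
- by rewrite !hom_src.
- by rewrite !hom_tgt.
- have ef : tgt Y (on_paths f x) = src Y (on_paths f y).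
    by rewrite hom_tgt e hom_src.
  by rewrite (hom_star e ef) (hom_star ef e').
Defined.

Definition Flow_cat : category.
Proof.
refine (@Category flow flow_hom flow_id flow_comp _ _ _) => *;
  exact: flow_homP.
Defined.

Definition empty_space : discreteTopologicalType := discrete_topology void.

Definition empty_flow : flow.
Proof.
refine (@Flow empty_space (discrete_cg empty_space) idfun idfun
  (fun x y _ => x) _ _ _ _) => [p|[]|[]|[]].
by case: (set_val p) => -[].
Defined.

Definition empty_flow_hom (X : flow) : flow_hom empty_flow X.
Proof.
have c : continuous (fun x : empty_space => of_void (paths X) x) by move=> [].
refine (@FlowHom empty_flow X (of_void (states X)) (mkcts c) _ _ _) => -[].
Defined.

Definition empty_flow_initial : initial_object Flow_cat.
Proof.
refine (@InitialObject Flow_cat empty_flow empty_flow_hom _) => X f g.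
by apply: flow_homP => -[].
Defined.
Definition branching_invariant (X : flow) (Z : Type) (phi : paths X -> Z) :
  Prop := forall (x y : paths X) (e : tgt X x = src X y), phi x = phi (star e).

Record branching (X : flow) := Branching {
  branching_space :> cgspace;
  branching_proj : continuousType (paths X) branching_space;
  branching_projP : branching_invariant branching_proj;
  branching_univ : forall (Z : cgspace) (phi : continuousType (paths X) Z),
    branching_invariant phi ->
    exists! psi : continuousType branching_space Z,
      psi \o branching_proj =1 phi
}.

Lemma compact_hausdorff_sub (K : topologicalType) (A : set K) :
  compact_hausdorff K -> closed A -> compact_hausdorff A.
Proof.
move=> [cK hK] clA; have cA := subclosed_compact clA cK (@subsetT _ A).
split.
- move=> F FF _; have [|p [Ap clp]] := cA ((set_val : A -> K) @ F).
    by rewrite nbhs_simpl /=; apply: (filterS _ filterT) => x _; exact: set_valP.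
  exists (exist _ p (mem_set Ap)); split=> // B N FB.
  rewrite nbhsE => -[W [[W' oW' WW'] Wp] WN].
  have nW' : nbhs p W'.
    by apply: open_nbhs_nbhs; split=> //; move: Wp; rewrite -WW' /=.
  have [|_ [[b Bb <-] W'b]] := clp (set_val @` B) W' _ nW'.
    by rewrite nbhs_simpl /=; apply: filterS FB => x Bx; exists x.
  by exists b; split=> //; apply: WN; rewrite -WW'.
- move=> x y xy; apply/val_inj; apply: hK => U V nU nV.
  have cv := @initial_continuous A K set_val.
  have [z [Uz Vz]] := xy _ _ (cv x _ nU) (cv y _ nV).
  by exists (set_val z).
Qed.

Lemma weak_hausdorff_image (Z K : topologicalType) (a : continuousType K Z)
  (A : set K) : weak_hausdorff Z -> compact_hausdorff K -> closed A ->
  closed (a @` A).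
Proof.
move=> wZ cK clA.
have ca : continuous (a \o (set_val : A -> K)).
  move=> x; apply: continuous_comp; last exact: cts_fun.
  exact: initial_continuous.
have := wZ _ (mkcts ca) (compact_hausdorff_sub cK clA).
congr closed; apply/seteqP; split=> [_ [x _ <-]|_ [x Ax <-]].
  by exists (set_val x) => //; exact: set_valP.
by exists (exist _ x (mem_set Ax)).
Qed.

Lemma weak_hausdorff_set1 (Z : topologicalType) (z : Z) :
  weak_hausdorff Z -> closed [set z].
Proof.
move=> wZ; pose T : discreteTopologicalType := discrete_topology unit.
have cT : compact_hausdorff T.
  split; last exact: discrete_hausdorff.
  apply: finite_compact; exact: finite_finset.
have := wZ _ (cst z : continuousType T Z) cT.
by congr closed; apply/seteqP; split=> [_ [x _ <-]|_ ->] //; exists (tt : T).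
Qed.

Lemma weak_hausdorff_eq_closed (Z K L : topologicalType)
  (a : continuousType K Z) (b : continuousType L Z) :
  weak_hausdorff Z -> compact_hausdorff K ->
  closed [set kl : K * L | a kl.1 = b kl.2].
Proof.
move=> wZ cK; rewrite -openC openE => -[k l] /= abN.
have cl1 z : closed (a @^-1` [set z]).
  apply: preimage_closed; first by move=> ? _; exact: cts_fun.
  exact: weak_hausdorff_set1.
have [U [V [oU oV kU lV UV]]] : exists U V : set K, [/\ open U, open V,
    a @^-1` [set a k] `<=` U, a @^-1` [set b l] `<=` V & U `&` V = set0].
  have nK := @compact_normal K cK.2 cK.1.
  have [|W aW clW] := nK _ (cl1 (a k)) (~` (a @^-1` [set b l])).
    move=> x /= ax; apply: open_nbhs_nbhs; split; last by rewrite /= ax.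
    by rewrite openC; exact: cl1.
  exists W^°, (~` closure W); split.
  - exact: open_interior.
  - by rewrite openC; exact: closed_closure.
  - by move=> x ax; exact: aW.
  - by move=> x bx /clW; exact.
  - apply/seteqP; split=> // x [/interior_subset Wx]; apply.
    exact: subset_closure.
have oI (U' : set K) : open U' -> open (~` (a @` ~` U')).
  move=> oU'; rewrite openC; apply: weak_hausdorff_image => //.
  by rewrite closedC.
exists (a @^-1` (~` (a @` ~` U)), b @^-1` (~` (a @` ~` V))) => /=.
  split; apply: open_nbhs_nbhs; split.
  - by apply: open_comp; [move=> ? _; exact: cts_fun | exact: oI].
  - by move=> -[x Ux] ax; apply: Ux; exact: kU.
  - by apply: open_comp; [move=> ? _; exact: cts_fun | exact: oI].
  - by move=> -[x Vx] ax; apply: Vx; exact: lV.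
move=> [x y] /= [xU yV] xy.
have Ux : U x by apply: contrapT => nUx; apply: xU; exists x.
have Vx : V x by apply: contrapT => nVx; apply: yV; exists x.
by have : (U `&` V) x by []; rewrite UV.
Qed.

(* The branching space is the quotient of the path space by the relation
   "every invariant map to a compactly generated space takes the same value",
   which turns out to be k-closed, so that the quotient is weak Hausdorff. *)
Section BranchingSpace.
Local Open Scope quotient_scope.
Variable X : flow.

Let rel_minus (x y : paths X) : bool :=
  `[< forall (Z : cgspace) (phi : continuousType (paths X) Z),
        branching_invariant phi -> phi x = phi y >].

Let rel_minus_refl : reflexive rel_minus.
Proof. by move=> x; apply/asboolP. Qed.

Let rel_minus_sym : symmetric rel_minus.
Proof.
by move=> x y; apply/asboolP/asboolP => h Z phi iphi; rewrite h.
Qed.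

Let rel_minus_trans : transitive rel_minus.
Proof.
move=> y x z /asboolP xy /asboolP yz; apply/asboolP => Z phi iphi.
by rewrite xy // yz.
Qed.

Canonical rel_minus_equiv :=
  EquivRel rel_minus rel_minus_refl rel_minus_sym rel_minus_trans.

Let quo : topologicalType := quotient_topology {eq_quot rel_minus_equiv}.
Let proj : paths X -> quo := \pi_(quotient_topology {eq_quot rel_minus_equiv}).

Let proj_continuous : continuous proj.
Proof. exact: pi_continuous. Qed.

Let proj_eqP (x y : paths X) : proj x = proj y <->
  forall (Z : cgspace) (phi : continuousType (paths X) Z),
    branching_invariant phi -> phi x = phi y.
Proof.
split=> [/eqmodP /asboolP //|h].
by apply/eqmodP; apply/asboolP.
Qed.

Let proj_surj (q : quo) : exists x, proj x = q.
Proof. by exists (repr q); exact: reprK. Qed.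

Let factor (Z : cgspace) (phi : continuousType (paths X) Z) :
  branching_invariant phi ->
  exists psi : continuousType quo Z, psi \o proj =1 phi.
Proof.
move=> iphi; pose g (q : quo) : Z := phi (repr q).
have gE x : g (proj x) = phi x.
  by have /proj_eqP/(_ Z phi iphi) : proj (repr (proj x)) = proj x by exact: reprK.
have cg : continuous g.
  apply/quotient_continuous; rewrite (_ : _ \o _ = phi); last exact/funext.
  exact: cts_fun.
by exists (mkcts cg).
Qed.

Let quo_k_space : k_space quo.
Proof.
move=> A oA; apply: (@cg_k_space (paths X)) => K u cK.
exact: (oA K (mkcts proj_continuous \o u)).
Qed.

Let quo_weak_hausdorff : weak_hausdorff quo.
Proof.
move=> K u cK; rewrite -[range u]setCK closedC.
change (open (proj @^-1` (~` range u))).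
rewrite preimage_setC openC.
apply: k_closed => L v cL.
pose D := [set lk : L * K | proj (v lk.1) = u lk.2].
have clD : closed D.
  rewrite -openC openE => -[l k] /= vu.
  have [y yE] := proj_surj (u k).
  have [Z [phi [iphi phiN]]] : exists (Z : cgspace)
      (phi : continuousType (paths X) Z), branching_invariant phi /\
      phi (v l) <> phi y.
    apply: contrapT => h; apply: vu; rewrite /D /= -yE.
    apply/proj_eqP => Z phi iphi; apply: contrapT => phiN.
    by apply: h; exists Z, phi.
  have [psi E] := factor iphi.
  pose E' := [set lk : L * K | (phi \o v) lk.1 = (psi \o u) lk.2].
  have oE' : open (~` E').
    rewrite openC; apply: (@weak_hausdorff_eq_closed Z L K (phi \o v) (psi \o u)).
      exact: cg_weak_hausdorff.
    by [].
  apply: (@filterS _ (nbhs (l, k)) _ (~` E')) => [[l' k'] /= nE' vu'|].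
    by apply: nE'; rewrite /E' /= -vu'; exact/esym/E.
  apply: open_nbhs_nbhs; split=> //.
  by rewrite /E' /= -yE => phiE; apply: phiN; rewrite phiE; exact: E.
have -> : v @^-1` (proj @^-1` range u) = fst @` D.
  apply/seteqP; split=> [l [k _ uk]|_ [[l k] vu <-]]; last by exists k.
  by exists (l, k).
apply: compact_closed; first exact: cL.2.
apply: continuous_compact.
  by apply: continuous_subspaceT => x; exact: cvg_fst.
apply: (subclosed_compact clD (compact_setX cL.1 cK.1)) => -[]; by [].
Qed.

Definition branching_of : branching X.
Proof.
refine (@Branching X (CGSpace quo_weak_hausdorff quo_k_space)
  (mkcts proj_continuous) _ _) => [x y e|Z phi iphi].
  by apply/proj_eqP => Z phi; exact.
have [psi E] := factor iphi; exists psi; split=> // psi' E'.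
apply/continuousEP => q; have [x <-] := proj_surj q.
by rewrite [LHS]E [RHS]E'.
Qed.

End BranchingSpace.

Definition branching_lift (X : flow) (B : branching X) (Z : cgspace)
  (phi : continuousType (paths X) Z) (iphi : branching_invariant phi) :
  continuousType B Z := sval (cid (branching_univ B iphi)).

Lemma branching_liftE (X : flow) (B : branching X) (Z : cgspace)
  (phi : continuousType (paths X) Z) (iphi : branching_invariant phi) x :
  branching_lift B iphi (branching_proj B x) = phi x.
Proof. by rewrite /branching_lift; case: cid => psi [+ _] /= => /(_ x). Qed.

Lemma branching_ext (X : flow) (B : branching X) (Z : cgspace)
  (f g : continuousType B Z) :
  f \o branching_proj B =1 g \o branching_proj B -> f =1 g.
Proof.
move=> fg.
have ig : branching_invariant (g \o branching_proj B).
  by move=> x y e /=; congr (g _); exact: branching_projP.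
have [psi [_ uniq_psi]] := branching_univ B ig.
by rewrite -(uniq_psi g (fun=> erefl)) -(uniq_psi f fg).
Qed.

Section BranchingFunctor.
Variables (X Y : flow) (f : flow_hom X Y).

Let branching_map_invariant :
  branching_invariant (branching_proj (branching_of Y) \o on_paths f).
Proof.
move=> x y e /=.
have e' : tgt Y (on_paths f x) = src Y (on_paths f y).
  by rewrite hom_tgt e hom_src.
by rewrite (hom_star e e'); exact: branching_projP.
Qed.

Definition branching_map :
  continuousType (branching_of X) (branching_of Y) :=
  branching_lift (branching_of X) branching_map_invariant.

Lemma branching_mapE x : branching_map (branching_proj (branching_of X) x) =
  branching_proj (branching_of Y) (on_paths f x).
Proof. exact: branching_liftE. Qed.

End BranchingFunctor.

Section BranchingSource.
Variable X : flow.

Let src_invariant : branching_invariant (src X).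
Proof. by move=> x y e; rewrite src_star. Qed.

Definition branching_src : continuousType (branching_of X) (states X) :=
  @branching_lift X (branching_of X) (discrete_cg (states X)) (src X)
    src_invariant.

Lemma branching_srcE x :
  branching_src (branching_proj (branching_of X) x) = src X x.
Proof.
exact (@branching_liftE X (branching_of X) (discrete_cg (states X)) (src X) src_invariant x).
Qed.

End BranchingSource.

Lemma branching_src_natural (X Y : flow) (f : flow_hom X Y)
  (b : branching_of X) :
  branching_src Y (branching_map f b) = on_states f (branching_src X b).
Proof.
have c : continuous (on_states f \o branching_src X).
  move=> x; apply: continuous_comp; first exact: cts_fun.
  by move=> A; rewrite !nbhs_principalE /= => /principal_filterP Ax;
    apply/principal_filterP.
apply: (@branching_ext X (branching_of X) (discrete_cg (states Y))
  (branching_src Y \o branching_map f) (mkcts c) _ b) => x /=.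
by rewrite /mkcts /= branching_mapE !branching_srcE hom_src.
Qed.

Section Homotopy.
Variable R : realType.

Definition interval : set R := `[0, 1].

Lemma interval0_subproof : interval 0.
Proof. by rewrite /interval /= in_itv /= lexx ler01. Qed.

Lemma interval1_subproof : interval 1.
Proof. by rewrite /interval /= in_itv /= lexx ler01. Qed.

Definition interval0 : interval := exist _ 0 (mem_set interval0_subproof).
Definition interval1 : interval := exist _ 1 (mem_set interval1_subproof).

Definition cube (n : nat) : set 'rV[R]_n :=
  [set u | forall i, u ord0 i \in `[0, 1]].

Arguments cube n : clear implicits.

Definition cube_boundary (n : nat) (u : cube n) : Prop :=
  exists i, (\val u) ord0 i = 0 \/ (\val u) ord0 i = 1.

Section WeakEquivalence.
Variable X : topologicalType.

Definition path_connected_points (x y : X) : Prop :=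
  exists g : continuousType interval X, g interval0 = x /\ g interval1 = y.

(* Maps of pairs from the n-cube and its boundary to [X] and [x], and homotopies
   of such maps: they represent the elements of the n-th homotopy group. *)
Definition spheroid (n : nat) (x : X) (a : continuousType (cube n) X) : Prop :=
  forall u, cube_boundary u -> a u = x.

Definition spheroid_homotopic (n : nat) (x : X)
    (a b : continuousType (cube n) X) : Prop :=
  exists h : continuousType (cube n * interval)%type X,
  [/\ forall u, h (u, interval0) = a u,
      forall u, h (u, interval1) = b u
    & forall u t, cube_boundary u -> h (u, t) = x].

End WeakEquivalence.

Section Maps.
Variables (X Y : topologicalType) (f : continuousType X Y).

Definition pi0_bijective : Prop :=
  (forall x x' : X,
     path_connected_points (f x) (f x') -> path_connected_points x x') /\
  (forall y : Y, exists x : X, path_connected_points (f x) y).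

(* Bijectivity of pi_n(X, x) -> pi_n(Y, f x); this map is always a group
   morphism, so that it is then an isomorphism. *)
Definition pi_bijective (n : nat) (x : X) : Prop :=
  (forall a b : continuousType (cube n) X, spheroid x a -> spheroid x b ->
     spheroid_homotopic (f x) (f \o a) (f \o b) -> spheroid_homotopic x a b) /\
  (forall c : continuousType (cube n) Y, spheroid (f x) c ->
     exists a : continuousType (cube n) X,
       spheroid x a /\ spheroid_homotopic (f x) (f \o a) c).

Definition weak_homotopy_equivalence : Prop :=
  pi0_bijective /\ forall (n : nat) (x : X), (0 < n)%N -> pi_bijective n x.

Definition serre_fibration : Prop :=
  forall (n : nat) (a : continuousType (cube n) X)
    (h : continuousType (cube n * interval)%type Y),
    (forall u, h (u, interval0) = f (a u)) ->
  exists l : continuousType (cube n * interval)%type X,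
    (forall u, l (u, interval0) = a u) /\ f \o l =1 h.

End Maps.

Definition weak_S_homotopy_equivalence (X Y : flow) (f : flow_hom X Y) : Prop :=
  bijective (on_states f) /\ weak_homotopy_equivalence (on_paths f).

Definition is_flow_model_structure (M : model_structure Flow_cat) : Prop :=
  (forall (X Y : flow) (f : flow_hom X Y),
     @weq Flow_cat M X Y f <-> weak_S_homotopy_equivalence f) /\
  (forall (X Y : flow) (f : flow_hom X Y),
     @fib Flow_cat M X Y f <-> serre_fibration (on_paths f)).

End Homotopy.

Section Homology.
Variables (A B C : zmodType) (f : {additive A -> B}) (g : {additive B -> C}).

Definition kernel : {pred B} := [pred b | g b == 0].

Let kernel_zmod_closed : zmod_closed kernel.
Proof.
split=> [|x y]; rewrite !inE ?raddf0 // => /eqP gx /eqP gy.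
by rewrite raddfB gx gy subr0.
Qed.

HB.instance Definition _ := GRing.isZmodClosed.Build B kernel kernel_zmod_closed.

Definition cycles := {b : B | b \in kernel}.

HB.instance Definition _ := SubChoice.on cycles.
HB.instance Definition _ := [SubChoice_isSubZmodule of cycles by <:].

(* When [g \o f = 0] this is the whole image of [f]; the definition does not
   need that hypothesis. *)
Definition boundaries : {pred cycles} :=
  fun z => `[< exists a : A, f a = \val z >].

Let boundaries_zmod_closed : zmod_closed boundaries.
Proof.
split=> [|x y]; rewrite !unfold_in.
  by apply/asboolP; exists 0; rewrite !raddf0.
move=> /asboolP[a fa] /asboolP[b fb]; apply/asboolP.
by exists (a - b); rewrite !raddfB /= fa fb.
Qed.

HB.instance Definition _ :=
  GRing.isZmodClosed.Build cycles boundaries boundaries_zmod_closed.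

Definition homology : zmodType := Quotient.quot boundaries.

End Homology.
Arguments boundaries {A B C} f g z.

Section HomologyMap.
Variables (A B C : zmodType) (f : {additive A -> B}) (g : {additive B -> C}).
Variables (A' B' C' : zmodType).
Variables (f' : {additive A' -> B'}) (g' : {additive B' -> C'}).
Variables (hA : {additive A -> A'}) (hB : {additive B -> B'}).
Variable hC : {additive C -> C'}.
Hypothesis hf : forall a, hB (f a) = f' (hA a).
Hypothesis hg : forall b, hC (g b) = g' (hB b).

Let cycles_map_subproof (z : cycles g) : hB (\val z) \in kernel g'.
Proof.
by have := valP z; rewrite !inE -hg => /eqP ->; rewrite raddf0.
Qed.

Definition cycles_map (z : cycles g) : cycles g' :=
  Sub (hB (\val z)) (cycles_map_subproof z).

Local Open Scope quotient_scope.

Definition homology_fun (u : homology f g) : homology f' g' :=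
  \pi_(homology f' g') (cycles_map (repr u)).

Lemma homology_funE (z : cycles g) :
  homology_fun (\pi_(homology f g) z) = \pi_(homology f' g') (cycles_map z).
Proof.
rewrite /homology_fun; apply/eqP; rewrite -Quotient.idealrBE.
have : repr (\pi_(homology f g) z) - z \in boundaries f g.
  by rewrite Quotient.idealrBE reprK.
rewrite !unfold_in => /asboolP[a fa]; apply/asboolP; exists (hA a).
by rewrite -hf fa raddfB.
Qed.

Let homology_fun_zmod_morphism : zmod_morphism homology_fun.
Proof.
move=> u v; rewrite -[u]reprK -[v]reprK -raddfB !homology_funE -raddfB.
congr (\pi_ _ _); apply/val_inj => /=.
exact: raddfB.
Qed.

HB.instance Definition _ := GRing.isZmodMorphism.Build
  (homology f g) (homology f' g') homology_fun homology_fun_zmod_morphism.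

Definition homology_map : {additive homology f g -> homology f' g'} :=
  homology_fun.

End HomologyMap.

Section FreeMap.
Variables (K L : choiceType).

Definition lin (F : K -> {freeg L / int}) : {freeg K / int} -> {freeg L / int} :=
  fglift F.

HB.instance Definition _ (F : K -> {freeg L / int}) :=
  GRing.isZmodMorphism.Build {freeg K / int} {freeg L / int} (lin F)
    (lift_is_additive F).

Lemma linU F x : lin F << x >> = F x.
Proof. by rewrite /lin liftU scale1r. Qed.

End FreeMap.

Section Simplices.
Variable R : realType.

Definition simplex (n : nat) : set 'rV[R]_n.+1 :=
  [set x | (forall i, 0 <= x ord0 i) /\ \sum_i x ord0 i = 1].
Arguments simplex n : clear implicits.

Lemma simplex0_subproof : simplex 0 (const_mx 1).
Proof.
by split=> [i|]; [rewrite mxE ler01 | rewrite big_ord1 mxE].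
Qed.

Definition simplex0 : simplex 0 := exist _ (const_mx 1) (mem_set simplex0_subproof).

Definition insert0 (n : nat) (i : 'I_n.+2) (x : 'rV[R]_n.+1) : 'rV[R]_n.+2 :=
  \row_j (if unlift i j is Some k then x ord0 k else 0).

Let insert0_simplex (n : nat) (i : 'I_n.+2) (x : simplex n) :
  simplex n.+1 (insert0 i (\val x)).
Proof.
have [x0 x1] := set_valP x; split=> [j|].
  by rewrite mxE; case: unlift.
rewrite (bigD1 i) //= mxE unlift_none add0r -x1.
rewrite (reindex_onto (fintype.lift i) (fun j => odflt ord0 (unlift i j))) /=; last first.
  by move=> j; rewrite eq_sym => /unlift_some[k -> uk]; rewrite uk.
apply: eq_big => [k|k _]; last by rewrite mxE liftK.
by rewrite eq_sym neq_lift liftK eqxx.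
Qed.

(* The i-th coface of the standard simplices, in barycentric coordinates. *)
Definition face_map (n : nat) (i : 'I_n.+2) (x : simplex n) : simplex n.+1 :=
  exist _ (insert0 i (\val x)) (mem_set (insert0_simplex i x)).

Let face_map_continuous (n : nat) (i : 'I_n.+2) : continuous (@face_map n i).
Proof.
apply: continuous_comp_initial => x A [P nP PA].
have cx : {for x, continuous (fun y : simplex n => \val y)}.
  exact: (@initial_continuous (simplex n) _ set_val).
have : \forall y \near x, forall j : 'I_n.+2, P ord0 j (insert0 i (\val y) ord0 j).
  apply: (@filter_forall _ _ (fun j (y : simplex n) =>
    P ord0 j (insert0 i (\val y) ord0 j)) (nbhs x)) => j.
  have := nP ord0 j; rewrite /= mxE => nPj.
  suff : nbhs x (fun y : simplex n =>
      P ord0 j (if unlift i j is Some k then (\val y) ord0 k else 0)).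
    by move=> h; apply: (@filterS _ (nbhs x) _ _ _ _ h) => y; rewrite mxE.
  case: (unlift i j) nPj => [k|] nPj; last first.
    by apply: (@filterE _ (nbhs x)) => y; exact: nbhs_singleton nPj.
  have ck : {for x, continuous (fun y : simplex n => (\val y) ord0 k)}.
    apply: (@continuous_comp _ _ _ (fun y : simplex n => \val y)
      (fun z : 'rV[R]_n.+1 => z ord0 k)); first exact: cx.
    exact: coord_continuous.
  exact: ck nPj.
move=> h; apply: (@filterS _ (nbhs x) _ _ _ _ h) => y Py.
by apply: PA => i' j; rewrite (ord1 i'); exact: Py.
Qed.

HB.instance Definition _ (n : nat) (i : 'I_n.+2) :=
  @isContinuous.Build _ _ (@face_map n i) (@face_map_continuous n i).

End Simplices.
Arguments simplex R n : clear implicits.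

Section AugmentedSingular.
Variables (R : realType) (T : topologicalType) (S : choiceType) (eps : T -> S).

(* Degrees are shifted by one: [aug_simplices n] is the set of simplices of
   dimension n - 1. *)
Definition aug_simplices (n : nat) : choiceType :=
  if n is k.+1 then continuousType (simplex R k) T else S.

Definition aug_face (n : nat) :
    'I_n.+1 -> aug_simplices n.+1 -> aug_simplices n :=
  match n with
  | 0 => fun _ (sigma : continuousType (simplex R 0) T) => eps (sigma (simplex0 R))
  | k.+1 => fun i (sigma : continuousType (simplex R k.+1) T) =>
      sigma \o @face_map R k i
  end.

Definition aug_chains (n : nat) : zmodType := {freeg (aug_simplices n) / int}.

Definition aug_bd (n : nat) : aug_chains n.+1 -> aug_chains n :=
  lin (fun sigma => \sum_(i < n.+1) << (-1) ^+ i *g aug_face i sigma >>).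

HB.instance Definition _ (n : nat) := GRing.Additive.on (@aug_bd n).

Definition aug_diff (n : nat) : {additive aug_chains n -> aug_chains n.-1} :=
  match n with 0 => \0 | k.+1 => @aug_bd k end.

Definition aug_homology (n : nat) : zmodType := homology (@aug_bd n) (aug_diff n).

End AugmentedSingular.
Arguments aug_bd R {T S} eps n.
Arguments aug_diff R {T S} eps n.

Section AugmentedSingularMap.
Variables (R : realType) (T T' : topologicalType) (S S' : choiceType).
Variables (eps : T -> S) (eps' : T' -> S').
Variables (F : continuousType T T') (G : S -> S').
Hypothesis epsF : forall x, eps' (F x) = G (eps x).

Definition aug_map (n : nat) : aug_simplices R T S n -> aug_simplices R T' S' n :=
  match n with
  | 0 => G
  | k.+1 => fun sigma : continuousType (simplex R k) T => F \o sigma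
  end.

Definition aug_chain_map (n : nat) :
    {additive aug_chains R T S n -> aug_chains R T' S' n} :=
  lin (fun sigma => << aug_map sigma >>).

Let aug_face_map n (i : 'I_n.+1) (sigma : aug_simplices R T S n.+1) :
  aug_map (aug_face eps i sigma) = aug_face eps' i (aug_map sigma).
Proof.
by case: n i sigma => [|n] i sigma /=; [rewrite epsF | apply/continuousEP].
Qed.

Let lin_ext (K : choiceType) (M : zmodType) (f g : {additive {freeg K / int} -> M}) :
  (forall x, f << x >> = g << x >>) -> f =1 g.
Proof.
move=> fg D; rewrite -(freeg_sumE D) !raddf_sum; apply: eq_bigr => z _.
by rewrite -[coeff z D]intz -freegU_mulz !raddfMz fg.
Qed.

Let aug_chain_map_bd n (c : aug_chains R T S n.+1) :
  aug_chain_map n (aug_bd R eps n c) = aug_bd R eps' n (aug_chain_map n.+1 c).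
Proof.
pose f : {additive _ -> _} := aug_chain_map n \o aug_bd R eps n.
pose g : {additive _ -> _} := aug_bd R eps' n \o aug_chain_map n.+1.
apply: (@lin_ext _ _ f g) => sigma /=.
rewrite /aug_bd !linU raddf_sum; apply: eq_bigr => i _.
rewrite -[X in << X *g _ >>]intz -freegU_mulz raddfMz /= linU aug_face_map.
by rewrite freegU_mulz intz.
Qed.

Let aug_chain_map_diff n (c : aug_chains R T S n) :
  aug_chain_map n.-1 (aug_diff R eps n c) = aug_diff R eps' n (aug_chain_map n c).
Proof. by case: n c => [|n] c; [rewrite /= raddf0 | exact: aug_chain_map_bd]. Qed.

Definition aug_homology_map (n : nat) :
    {additive aug_homology R eps n -> aug_homology R eps' n} :=
  @homology_map _ _ _ (aug_bd R eps n) (aug_diff R eps n) _ _ _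
    (aug_bd R eps' n) (aug_diff R eps' n) (aug_chain_map n.+1)
    (aug_chain_map n) (aug_chain_map n.-1) (@aug_chain_map_bd n)
    (@aug_chain_map_diff n).

End AugmentedSingularMap.

Section BranchingHomology.
Variables (R : realType) (M : model_structure Flow_cat).

Definition flow_cofrep (X : flow) : flow := cofrep M empty_flow_initial X.

Definition flow_cofrep_proj (X : flow) : flow_hom (flow_cofrep X) X :=
  cofrep_proj M empty_flow_initial X.

Definition flow_cofrep_map (X Y : flow) (f : flow_hom X Y) : flow_hom (flow_cofrep X) (flow_cofrep Y) :=
  @cofrep_map Flow_cat M empty_flow_initial X Y f.

Definition ho_branching (X : flow) : cgspace := branching_of (flow_cofrep X).

Definition ho_branching_map (X Y : flow) (f : flow_hom X Y) :
  continuousType (ho_branching X) (ho_branching Y) := branching_map (flow_cofrep_map f).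

(* The identification of the states of [flow_cofrep X] with those of [X] is given by
   [flow_cofrep_proj X]. *)
Definition ho_branching_src (X : flow) (b : ho_branching X) : states X :=
  on_states (flow_cofrep_proj X) (branching_src (flow_cofrep X) b).

Let ho_branching_src_natural (X Y : flow) (f : flow_hom X Y)
  (b : ho_branching X) :
  ho_branching_src (ho_branching_map f b) = on_states f (ho_branching_src b).
Proof.
rewrite /ho_branching_src branching_src_natural.
have /(congr1 (fun h : flow_hom (flow_cofrep X) Y => on_states h (branching_src (flow_cofrep X) b))) :=
  @cofrep_proj_natural Flow_cat M empty_flow_initial X Y f.
by [].
Qed.

(* [branching_homology n X] is the homology at [aug_chains n], that is, the
   homology of the augmented simplicial set in degree n - 1. *)
Definition branching_homology (n : nat) (X : flow) : zmodType :=
  aug_homology R (@ho_branching_src X) n.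

Definition branching_homology_map (n : nat) (X Y : flow) (f : flow_hom X Y) :
    {additive branching_homology n X -> branching_homology n Y} :=
  aug_homology_map R (ho_branching_src_natural f) n.

End BranchingHomology.

(* Main.v *)
(* Q(f) is a weak equivalence g : A -> B between cofibrant flows, and every flow
   is fibrant. Factor g = q j with j a trivial cofibration and q a trivial
   fibration; q has a section u because B is cofibrant. For j : A -> W take the
   flow E of pairs (a, gamma) with gamma a path in PW starting at j(a); its end
   point map E -> W is a fibration, so that j lifts against it, and the lift
   W -> E is a retraction r of j together with an S-homotopy from j r to the
   identity. Hence s = r u is a weak equivalence with g s S-homotopic to the
   identity; apply the same to s.
   S-homotopic morphisms induce homotopic maps of branching spaces, since a
   homotopy is a map to a space of paths and so factors through the branching
   space by its universal property; homotopic maps over the same map of states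
   induce the same map in augmented singular homology by the prism operator. *)

Require Import Defs.
From mathcomp Require Import all_boot all_order all_algebra.
From mathcomp Require Import all_classical all_reals.
From mathcomp Require Import topology normedtype.
From mathcomp Require Import ring_quotient freeg zify.

Set Implicit Arguments.
Unset Strict Implicit.
Unset Printing Implicit Defensive.

Import Order.TTheory GRing.Theory Num.Theory.
Import numFieldNormedType.Exports.
(* Again, because [all_algebra] has shadowed [interval]. *)
Import Defs.

Local Open Scope classical_set_scope.
Local Open Scope ring_scope.

Arguments interval R _ : clear implicits.
Arguments cube R n _ : clear implicits.

(** * The prism operator on lists of vertices *)

Lemma additive_ext (K : choiceType) (A : zmodType)
    (f g : {additive {freeg K / int} -> A}) :
  (forall x, f << x >> = g << x >>) -> f =1 g.
Proof.
move=> fg D; rewrite -(freeg_sumE D) !raddf_sum; apply: eq_bigr => z _.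
by rewrite -[coeff z D]intz -freegU_mulz !raddfMz fg.
Qed.

Lemma raddfUz (K : choiceType) (A : zmodType)
    (f : {additive {freeg K / int} -> A}) (a : int) x :
  f << a *g x >> = f << x >> *~ a.
Proof. by rewrite -[X in << X *g _ >>]intz -freegU_mulz raddfMz. Qed.

Section Prism.

(** The cone operator with apex [v] on ordered chains, whose simplices may repeat vertices. *)
Definition cons_chain (V : choiceType) (v : V) :
    {additive {freeg (seq V) / int} -> {freeg (seq V) / int}} :=
  lin (fun l => << v :: l >>).

Definition map_chain (V W : choiceType) (f : V -> W) :
    {additive {freeg (seq V) / int} -> {freeg (seq W) / int}} :=
  lin (fun l => << map f l >>).

(* A list of length [n] stands for an (n - 1)-simplex, so that the empty list is
   the augmentation simplex and no case distinction is needed below. *)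
Fixpoint list_bd (V : choiceType) (l : seq V) : {freeg (seq V) / int} :=
  if l is v :: l' then << l' >> - cons_chain v (list_bd l') else 0.

Definition list_remove (V : Type) (i : nat) (l : seq V) :=
  take i l ++ drop i.+1 l.

(** The recursive boundary suits inductions on cones; the alternating sum is the form in which
    [aug_bd] is given. *)
Lemma list_bdE (V : choiceType) (l : seq V) :
  list_bd l = \sum_(i < size l) << (-1) ^+ i *g list_remove i l >>.
Proof.
elim: l => [|v l IH] /=; first by rewrite big_ord0.
rewrite big_ord_recl expr0 /list_remove /= drop0 IH raddf_sum -sumrN.
congr (_ + _); apply: eq_bigr => i _.
by rewrite raddfUz /= linU freegU_mulz intz freegUN exprS mulN1r.
Qed.

(** The cone formula. It holds in every degree because the empty list counts as a simplex. *)
Lemma list_bd_cons (V : choiceType) (v : V) c :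
  lin (@list_bd V) (cons_chain v c) = c - cons_chain v (lin (@list_bd V) c).
Proof.
pose f : {additive _ -> _} := lin (@list_bd V) \o cons_chain v.
pose g : {additive _ -> _} := idfun \- (cons_chain v \o lin (@list_bd V)).
by apply: (@additive_ext _ _ f g) => l; rewrite /= !linU.
Qed.

Variable K : choiceType.

(* The prism over the simplex [i :: l] is the cone with apex [(i, false)] over the
   union of its top face and of the prism over [l]. *)
Fixpoint prism (l : seq K) : {freeg (seq (K * bool)%type) / int} :=
  if l is i :: l' then
    << (i, false) :: (i, true) :: map (pair^~ true) l' >>
    - cons_chain (i, false) (prism l')
  else 0.

Lemma prism_cons i c : lin prism (cons_chain i c) =
  cons_chain (i, false) (cons_chain (i, true) (map_chain (pair^~ true) c))
  - cons_chain (i, false) (lin prism c).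
Proof.
pose f : {additive _ -> _} := lin prism \o cons_chain i.
pose g : {additive _ -> _} := (cons_chain (i, false) \o (cons_chain (i, true)
  \o map_chain (pair^~ true))) \- (cons_chain (i, false) \o lin prism).
by apply: (@additive_ext _ _ f g) => l; rewrite /= !linU.
Qed.

Lemma list_bd_map (V W : choiceType) (f : V -> W) l :
  list_bd (map f l) = map_chain f (list_bd l).
Proof.
elim: l => [|v l IH] /=; first by rewrite raddf0.
rewrite raddfB /= linU IH; congr (_ - _).
pose g : {additive _ -> _} := cons_chain (f v) \o map_chain f.
pose h : {additive _ -> _} := map_chain f \o cons_chain v.
by apply: (@additive_ext _ _ g h) => k; rewrite /= !linU.
Qed.

(** By induction on the list: the cone formula rewrites the boundary of each cone, and the induction
    hypothesis that of the smaller prism. *)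
Lemma prism_bd (l : seq K) :
  lin (@list_bd _) (prism l) + lin prism (list_bd l) =
  << map (pair^~ true) l >> - << map (pair^~ false) l >>.
Proof.
elim: l => [|i l IH] /=; first by rewrite !raddf0 addr0 subrr.
rewrite !raddfB /= !linU /= list_bd_cons prism_cons list_bd_map !raddfB /= linU.
have -> : lin (@list_bd _) (prism l) = << map (pair^~ true) l >>
    - << map (pair^~ false) l >> - lin prism (list_bd l).
  by rewrite -IH addrK.
rewrite !raddfB /= !linU.
rewrite !opprK !addrA.
(* Of the ten terms the first and the sixth are the two ends of the prism; the others cancel in the
   pairs shown. *)
rewrite [LHS](ACl (1*6*(2*5)*(3*9)*(4*8)*(7*10))) /=.
by rewrite !addNr !subrr !addr0.
Qed.

End Prism.

(** Every list in the prism over [l] has one vertex more than [l]. This length condition is what the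
    face formulas for realized simplices require. *)
Lemma prism_ext (K : choiceType) (A : zmodType) (l : seq K)
    (f g : {additive {freeg (seq (K * bool)%type) / int} -> A}) :
  (forall l', size l' = (size l).+1 -> f << l' >> = g << l' >>) ->
  f (prism l) = g (prism l).
Proof.
elim: l f g => [|i l IH] f g fg /=; first by rewrite !raddf0.
rewrite !raddfB fg /= ?size_map //; congr (_ - _).
apply: (IH (f \o cons_chain (i, false)) (g \o cons_chain (i, false))) => l' sl'.
by rewrite /= linU fg //= sl'.
Qed.

Lemma prism_map (K L : choiceType) (f : K -> L) (l : seq K) :
  prism (map f l) = map_chain (fun v : K * bool => (f v.1, v.2)) (prism l).
Proof.
elim: l => [|i l IH] /=; first by rewrite raddf0.
rewrite raddfB /= linU /= -!map_comp IH; congr (_ - _).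
pose g : {additive _ -> _} := cons_chain (f i, false)
  \o map_chain (fun v : K * bool => (f v.1, v.2)).
pose h : {additive _ -> _} := map_chain (fun v : K * bool => (f v.1, v.2))
  \o cons_chain (i, false).
by apply: (@additive_ext _ _ g h) => k; rewrite /= !linU.
Qed.

Lemma nth_list_remove (V : Type) (v : V) (i k : nat) (l : seq V) :
  (i < size l)%N -> nth v (list_remove i l) k = nth v l (bump i k).
Proof.
move=> il; rewrite /list_remove nth_cat size_take il /bump.
case: ltnP => ki; first by rewrite nth_take // leqNgt ki.
by rewrite nth_drop; congr nth; lia.
Qed.

Lemma list_remove_enum n (i : 'I_n.+2) :
  list_remove i (enum 'I_n.+2) = map (fintype.lift i) (enum 'I_n.+1).
Proof.
apply: (@eq_from_nth _ ord0) => [|k].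
  by rewrite /list_remove size_cat size_take size_drop size_map !size_enum_ord
    ltn_ord; have := ltn_ord i; lia.
rewrite /list_remove size_cat size_take size_drop !size_enum_ord ltn_ord => kn.
have {}kn : (k < n.+1)%N by have := ltn_ord i; lia.
apply: ord_inj; rewrite nth_list_remove ?size_enum_ord //.
rewrite [in RHS](nth_map ord0) ?size_enum_ord // [in RHS]/= !nth_enum_ord //; last first.
  by rewrite /bump; lia.
Qed.

(** * Homotopy invariance of augmented singular homology *)

Lemma continuous_rV (R : realType) (T : topologicalType) n (f : T -> 'rV[R]_n) :
  (forall i, continuous (fun x => f x ord0 i)) -> continuous f.
Proof.
move=> cf x A [P nP PA].
have : \forall y \near x, forall j : 'I_n, P ord0 j (f y ord0 j).
  apply: filter_forall => j; exact: cf (nP ord0 j).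
apply: (@filterS _ (nbhs x)) => y Py.
by apply: PA => i' j; rewrite (ord1 i'); exact: Py.
Qed.

Lemma continuous_set_type (T X : topologicalType) (A : set X) (f : T -> A) :
  continuous (fun x => \val (f x)) -> continuous f.
Proof. by move=> cf; apply: continuous_comp_initial. Qed.

Lemma set_val_continuous (X : topologicalType) (A : set X) :
  continuous (\val : A -> X).
Proof. exact: (@initial_continuous A X set_val). Qed.

Lemma simplex_coord_continuous (R : realType) n i :
  continuous (fun x : simplex R n => \val x ord0 i).
Proof.
move=> x; apply: (@continuous_comp _ _ _ (fun y : simplex R n => \val y)
  (fun z : 'rV[R]_n.+1 => z ord0 i)); first exact: set_val_continuous.
exact: coord_continuous.
Qed.

Lemma continuous_linear_comb (R : realType) (T : topologicalType) n
    (f : 'I_n -> T -> R) (c : 'I_n -> R) :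
  (forall i, continuous (f i)) -> continuous (fun x => \sum_(i < n) f i x * c i).
Proof.
move=> cf x; elim: n f c cf => [|n IH] f c cf.
  under [X in _ X]eq_fun do rewrite big_ord0; exact: cst_continuous.
under [X in _ X]eq_fun do rewrite big_ord_recl.
apply: cvgD; last by apply: IH => i; exact: cf.
by apply: (@continuousM R T (f ord0) (cst (c ord0))); [exact: cf | exact: cvg_cst].
Qed.

Lemma continuous_pair (X Y Z : topologicalType) (f : X -> Y) (g : X -> Z) :
  continuous f -> continuous g -> continuous (fun x => (f x, g x)).
Proof. by move=> cf cg x; apply: (cvg_pair (cf x) (cg x)). Qed.

Lemma continuous_compose (X Y Z : topologicalType) (f : X -> Y) (g : Y -> Z) :
  continuous f -> continuous g -> continuous (fun x => g (f x)).
Proof. by move=> cf cg x; apply: (continuous_comp (cf x)); exact: cg. Qed.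

Definition homotopic (R : realType) (T T' : topologicalType)
    (F G : continuousType T T') : Prop :=
  exists H : continuousType (T * interval R)%type T',
    (forall x, H (x, interval0 R) = F x) /\ (forall x, H (x, interval1 R) = G x).

(** * Affine simplices in the prism over a standard simplex *)

Section Realization.
Variables (R : realType) (n : nat).
Implicit Type l : seq ('I_n.+1 * bool)%type.

(* The default vertex is never reached when [size l] is the number of vertices. *)
Definition vertex l j : ('I_n.+1 * bool)%type := nth (ord0, false) l j.

(** A list of vertices spans an affine simplex in the product of the standard n-simplex with the
    interval; this is its first component in barycentric coordinates, and [height_sum] is the
    second. *)
Definition base_row l m (x : 'rV[R]_m.+1) : 'rV[R]_n.+1 :=
  \row_i \sum_(j < m.+1) x ord0 j * ((vertex l j).1 == i)%:R.

Definition height_sum l m (x : 'rV[R]_m.+1) : R :=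
  \sum_(j < m.+1) x ord0 j * (vertex l j).2%:R.

Lemma base_row_simplex l m (x : simplex R m) : simplex R n (base_row l (\val x)).
Proof.
have [x0 x1] := set_valP x; split=> [i|].
  by rewrite mxE; apply: sumr_ge0 => j _; rewrite mulr_ge0 ?ler0n.
under eq_bigr do rewrite mxE.
rewrite exchange_big /= -[RHS]x1; apply: eq_bigr => j _.
rewrite -mulr_sumr (bigD1 (vertex l j).1) //= eqxx big1 ?addr0 ?mulr1 // => i ij.
by rewrite eq_sym (negbTE ij).
Qed.

Lemma height_sum_interval l m (x : simplex R m) :
  interval R (height_sum l (\val x)).
Proof.
have [x0 x1] := set_valP x; rewrite /interval /= in_itv /=; apply/andP; split.
  by apply: sumr_ge0 => j _; rewrite mulr_ge0 ?ler0n.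
rewrite -[leRHS]x1; apply: ler_sum => j _.
by rewrite ler_piMr // lern1 leq_b1.
Qed.

Definition base l m (x : simplex R m) : simplex R n :=
  exist _ (base_row l (\val x)) (mem_set (base_row_simplex l x)).

Definition height l m (x : simplex R m) : interval R :=
  exist _ (height_sum l (\val x)) (mem_set (height_sum_interval l x)).

Lemma base_continuous l m : continuous (@base l m).
Proof.
apply: continuous_set_type => /=; apply: continuous_rV => i.
under [X in continuous X]eq_fun do rewrite mxE.
apply: continuous_linear_comb => j; exact: simplex_coord_continuous.
Qed.

Lemma height_continuous l m : continuous (@height l m).
Proof.
apply: continuous_set_type => /=.
apply: continuous_linear_comb => j; exact: simplex_coord_continuous.
Qed.

Variables (T T' : topologicalType) (H : continuousType (T * interval R)%type T').

Lemma realize_continuous (sigma : continuousType (simplex R n) T) l m :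
  continuous (fun x : simplex R m => H (sigma (base l x), height l x)).
Proof.
apply: (@continuous_compose _ _ _
  (fun x : simplex R m => (sigma (base l x), height l x)) H); last exact: cts_fun.
apply: continuous_pair; last exact: height_continuous.
apply: (@continuous_compose _ _ _ (@base l m) sigma); last exact: cts_fun.
exact: base_continuous.
Qed.

Definition realize (sigma : continuousType (simplex R n) T) m l :
    continuousType (simplex R m) T' := mkcts (@realize_continuous sigma l m).

Lemma sum_insert0 m (i : 'I_m.+2) (x : 'rV[R]_m.+1) (a : nat -> R) :
  \sum_(j < m.+2) insert0 i x ord0 j * a j =
  \sum_(j < m.+1) x ord0 j * a (bump i j).
Proof.
rewrite (bigD1_ord i) //= mxE unlift_none mul0r add0r.
by apply: eq_bigr => j _; rewrite mxE liftK.
Qed.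

(** A coface inserts a zero barycentric coordinate, so the i-th vertex gets weight zero and may be
    dropped from the list. *)
Lemma realize_face sigma m l (i : 'I_m.+2) : size l = m.+2 ->
  realize sigma m.+1 l \o @face_map R m i = realize sigma m (list_remove i l)
  :> continuousType _ _.
Proof.
move=> sl; apply/continuousEP => x /=; rewrite /mkcts.
have vE j : vertex (list_remove i l) j = vertex l (bump i j).
  by apply: nth_list_remove; rewrite sl.
congr (H (sigma _, _)); apply: val_inj => /=.
  apply/rowP => k; rewrite !mxE (sum_insert0 _ _ (fun j => ((vertex l j).1 == k)%:R)).
  by apply: eq_bigr => j _; rewrite vE.
rewrite /height_sum (sum_insert0 _ _ (fun j => (vertex l j).2%:R)).
by apply: eq_bigr => j _; rewrite vE.
Qed.

(** On the list of all vertices at level [b] the base is the identity, and the height is constant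
    since barycentric coordinates sum to one. *)
Lemma realize_prism_end sigma b (x : simplex R n) :
  realize sigma n (map (pair^~ b) (enum 'I_n.+1)) x =
  H (sigma x, if b then interval1 R else interval0 R).
Proof.
have vE (j : 'I_n.+1) : vertex (map (pair^~ b) (enum 'I_n.+1)) j = (j, b).
  by rewrite /vertex (nth_map ord0) ?size_enum_ord // nth_ord_enum.
have [_ x1] := set_valP x.
rewrite /realize /mkcts; congr (H (sigma _, _)); apply: val_inj => /=.
  apply/rowP => k; rewrite mxE (bigD1 k) //= vE eqxx mulr1 big1 ?addr0 // => j jk.
  by rewrite vE /= (negbTE jk) mulr0.
rewrite /height_sum; under eq_bigr do rewrite vE /=.
by rewrite -mulr_suml x1 mul1r; case: b {vE}.
Qed.

End Realization.

(** Cofaces are affine, so moving the vertices by a coface amounts to composing [sigma] with it. *)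
Lemma realize_lift (R : realType) (T T' : topologicalType)
    (H : continuousType (T * interval R)%type T') n (i : 'I_n.+2)
    (sigma : continuousType (simplex R n.+1) T) m (l : seq ('I_n.+1 * bool)%type) :
  size l = m.+1 ->
  realize H sigma m (map (fun v => (fintype.lift i v.1, v.2)) l) =
  realize H (sigma \o @face_map R n i) m l.
Proof.
move=> sl; apply/continuousEP => x; rewrite /realize /mkcts /=.
have vE (j : 'I_m.+1) :
    vertex (map (fun v : 'I_n.+1 * bool => (fintype.lift i v.1, v.2)) l) j =
    (fintype.lift i (vertex l j).1, (vertex l j).2).
  by rewrite /vertex (nth_map (ord0, false)) ?sl.
congr (H (sigma _, _)); apply: val_inj => /=.
  apply/rowP => k; rewrite !mxE; case: unliftP => [k' ->|->].
    by rewrite mxE; apply: eq_bigr => j _; rewrite vE (inj_eq lift_inj).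
  by rewrite big1 // => j _; rewrite vE /= eq_sym (negbTE (neq_lift _ _)) mulr0.
by apply: eq_bigr => j _; rewrite vE.
Qed.

(** * The prism chain homotopy *)

Section ChainHomotopy.
Variables (R : realType) (T T' : topologicalType) (S S' : choiceType).
Variables (eps : T -> S) (eps' : T' -> S') (G : S -> S').
Variable H : continuousType (T * interval R)%type T'.

Definition realize_chain n (sigma : continuousType (simplex R n) T) m :
    {additive {freeg (seq ('I_n.+1 * bool)%type) / int} -> aug_chains R T' S' m.+1} :=
  lin (fun l => << realize H sigma m l : aug_simplices R T' S' m.+1 >>).

Lemma realize_chain_bd n (sigma : continuousType (simplex R n) T) m l :
  size l = m.+2 ->
  aug_bd R eps' m.+1 (realize_chain sigma m.+1 << l >>) =
  realize_chain sigma m (list_bd l).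
Proof.
move=> sl; rewrite /= linU /aug_bd linU list_bdE raddf_sum /= sl.
apply: eq_bigr => i _; rewrite raddfUz /= linU freegU_mulz intz.
by rewrite -realize_face.
Qed.

(** Index zero is the augmentation, where the homotopy vanishes just as the prism over the empty
    list does. *)
Definition prism_chain n :
    {additive aug_chains R T S n -> aug_chains R T' S' n.+1} :=
  match n with
  | 0 => \0
  | k.+1 => lin (fun sigma : aug_simplices R T S k.+1 =>
      realize_chain sigma k.+1 (prism (enum 'I_k.+1)))
  end.

Lemma prism_chain_face n (sigma : continuousType (simplex R n) T) :
  prism_chain n (aug_bd R eps n << sigma : aug_simplices R T S n.+1 >>) =
  realize_chain sigma n (lin (@prism _) (list_bd (enum 'I_n.+1))).
Proof.
case: n sigma => [|n] sigma.
  (* The boundary of a single vertex is the empty list, whose prism is zero. *)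
  case: (enum 'I_1) (size_enum_ord 1) => [|x [|y s]] //= _.
  by rewrite raddf0 subr0 linU raddf0.
rewrite /aug_bd linU list_bdE !raddf_sum /= size_enum_ord.
apply: eq_bigr => i _; rewrite raddfUz [in RHS]raddfUz [in RHS]raddfMz.
congr (_ *~ _); rewrite /= !linU.
(* The prism over the i-th face is the image under the coface of the prism over the smaller standard
   simplex. *)
rewrite list_remove_enum (prism_map (fintype.lift i)).
pose g : {additive _ -> _} := realize_chain sigma n.+1 \o
  map_chain (fun v : 'I_n.+1 * bool => (fintype.lift i v.1, v.2)).
apply: (@prism_ext _ _ _ (realize_chain (sigma \o @face_map R n i) n.+1) g) => l.
by rewrite size_enum_ord => sl; rewrite /= !linU realize_lift.
Qed.

Variables F0 F1 : continuousType T T'.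
Hypothesis HF0 : forall x, H (x, interval0 R) = F0 x.
Hypothesis HF1 : forall x, H (x, interval1 R) = F1 x.

Lemma prism_chain_homotopy n (c : aug_chains R T S n.+1) :
  aug_bd R eps' n.+1 (prism_chain n.+1 c) + prism_chain n (aug_bd R eps n c) =
  aug_chain_map R F1 G n.+1 c - aug_chain_map R F0 G n.+1 c.
Proof.
pose f : {additive _ -> _} := (aug_bd R eps' n.+1 \o prism_chain n.+1)
  \+ (prism_chain n \o aug_bd R eps n).
pose g : {additive _ -> _} := aug_chain_map R F1 G n.+1 \- aug_chain_map R F0 G n.+1.
apply: (@additive_ext _ _ f g) => sigma; rewrite /f /g /=.
rewrite prism_chain_face !linU.
pose p : {additive _ -> _} := aug_bd R eps' n.+1 \o realize_chain sigma n.+1.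
pose q : {additive _ -> _} := realize_chain sigma n \o lin (@list_bd _).
have -> : aug_bd R eps' n.+1 (realize_chain sigma n.+1 (prism (enum 'I_n.+1))) =
    realize_chain sigma n (lin (@list_bd _) (prism (enum 'I_n.+1))).
  apply: (@prism_ext _ _ _ p q) => l; rewrite size_enum_ord => sl.
  rewrite -[q _]/(realize_chain sigma n (lin (@list_bd _) << l >>)) linU.
  exact: realize_chain_bd.
rewrite -raddfD prism_bd raddfB /= !linU.
congr (<< _ >> - << _ >>); apply/continuousEP => x.
  by rewrite (realize_prism_end H sigma true) HF1.
by rewrite (realize_prism_end H sigma false) HF0.
Qed.

End ChainHomotopy.

(** * Induced maps in augmented singular homology *)

Lemma homology_mapE (A B C A' B' C' : zmodType)
    (f : {additive A -> B}) (g : {additive B -> C})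
    (f' : {additive A' -> B'}) (g' : {additive B' -> C'})
    (hA : {additive A -> A'}) (hB : {additive B -> B'}) (hC : {additive C -> C'})
    (hf : forall a, hB (f a) = f' (hA a)) (hg : forall b, hC (g b) = g' (hB b))
    (z : cycles g) :
  homology_map hf hg (\pi_(homology f g) z)%qT =
  (\pi_(homology f' g') (cycles_map hg z))%qT.
Proof. exact: homology_funE. Qed.

Lemma aug_homology_map_homotopic (R : realType) (T T' : topologicalType)
    (S S' : choiceType) (eps : T -> S) (eps' : T' -> S')
    (F0 F1 : continuousType T T') (G0 G1 : S -> S')
    (epsF0 : forall x, eps' (F0 x) = G0 (eps x))
    (epsF1 : forall x, eps' (F1 x) = G1 (eps x)) n :
  homotopic R F0 F1 -> G0 =1 G1 ->
  aug_homology_map R epsF0 n =1 aug_homology_map R epsF1 n.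
Proof.
move=> [H [HF0 HF1]] /funext eG; case: _ / eG in epsF1 * => u; rewrite -[u]reprK.
rewrite /aug_homology_map !homology_mapE.
apply/esym/eqP; rewrite -Quotient.idealrBE unfold_in.
apply/asboolP; exists (prism_chain S S' H n (\val (repr u))); rewrite raddfB /=.
have := valP (repr u); rewrite inE.
(* At index zero the chains are combinations of states, on which both maps agree. Above it the
   homotopy formula, applied to a cycle, leaves only the boundary of its prism. *)
case: n u => [|n] u.
  by rewrite raddf0 subrr.
move=> /eqP z; have {}z : aug_bd R eps n (\val (repr u)) = 0 by exact: z.
rewrite -(prism_chain_homotopy eps eps' G0 HF0 HF1).
by rewrite z raddf0 addr0.
Qed.

Lemma aug_homology_map_comp (R : realType) (T T' T'' : topologicalType)
    (S S' S'' : choiceType) (eps : T -> S) (eps' : T' -> S') (eps'' : T'' -> S'')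
    (F : continuousType T T') (F' : continuousType T' T'')
    (G : S -> S') (G' : S' -> S'')
    (epsF : forall x, eps' (F x) = G (eps x))
    (epsF' : forall x, eps'' (F' x) = G' (eps' x))
    (epsF'' : forall x, eps'' ((F' \o F) x) = (G' \o G) (eps x)) n u :
  aug_homology_map R epsF' n (aug_homology_map R epsF n u) =
  aug_homology_map R epsF'' n u.
Proof.
rewrite -[u]reprK; move: (repr u) => z; rewrite /aug_homology_map.
rewrite !(homology_mapE _ _ z) homology_mapE; congr (\pi_ _ _)%qT; apply: val_inj.
pose f : {additive _ -> _} := aug_chain_map R F' G' n \o aug_chain_map R F G n.
suff fE : f =1 aug_chain_map R (F' \o F) (G' \o G) n by exact: (fE (\val z)).
apply: additive_ext => s; rewrite /f /= !linU; congr << _ >>.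
by case: n s {u z f} => [|n] s //=; apply/continuousEP.
Qed.

Lemma aug_homology_map_id (R : realType) (T : topologicalType) (S : choiceType)
    (eps : T -> S) (epsF : forall x, eps (idfun x) = idfun (eps x)) n u :
  aug_homology_map R (F := idfun) epsF n u = u.
Proof.
rewrite -[u]reprK; move: (repr u) => z; rewrite /aug_homology_map homology_mapE.
congr (\pi_ _ _)%qT; apply: val_inj.
pose f : {additive _ -> _} := @idfun (aug_chains R T S n).
suff fE : aug_chain_map R idfun idfun n =1 f by exact: (fE (\val z)).
apply: additive_ext => s; rewrite /f /= !linU; congr << _ >>.
by case: n s {u z f} => [|n] s //=; apply/continuousEP.
Qed.

(** * The unit interval and the cubes *)

(** Points without disjoint neighbourhoods keep this property under continuous maps, so they have
    equal images in every Hausdorff space. *)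
Lemma hausdorff_separated (X : topologicalType) :
  (forall x y : X, (forall (Z : topologicalType) (f : X -> Z),
     hausdorff_space Z -> continuous f -> f x = f y) -> x = y) ->
  hausdorff_space X.
Proof.
move=> sep x y xy; apply: sep => Z f hZ cf; apply: hZ => U V nU nV.
have [z [Uz Vz]] := xy _ _ (cf x _ nU) (cf y _ nV).
by exists (f z).
Qed.

Lemma compact_hausdorff_set (X : topologicalType) (A : set X) :
  compact A -> hausdorff_space X -> compact_hausdorff A.
Proof.
move=> cA hX; split; last first.
  apply: hausdorff_separated => x y xy; apply: val_inj.
  by apply: xy; last exact: set_val_continuous.
move=> F FF _; have [|p [Ap clp]] := cA ((set_val : A -> X) @ F).
  by rewrite nbhs_simpl /=; apply: (filterS _ filterT) => x _; exact: set_valP.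
exists (exist _ p (mem_set Ap)); split=> // B N FB.
rewrite nbhsE => -[W [[W' oW' WW'] Wp] WN].
have nW' : nbhs p W'.
  by apply: open_nbhs_nbhs; split=> //; move: Wp; rewrite -WW' /=.
have [|_ [[b Bb <-] W'b]] := clp (set_val @` B) W' _ nW'.
  by rewrite nbhs_simpl /=; apply: filterS FB => x Bx; exists x.
by exists b; split=> //; apply: WN; rewrite -WW'.
Qed.

Lemma compact_hausdorff_prod (K L : topologicalType) :
  compact_hausdorff K -> compact_hausdorff L ->
  compact_hausdorff (K * L)%type.
Proof.
move=> [cK hK] [cL hL]; split.
  by rewrite -setXTT; exact: compact_setX.
apply: hausdorff_separated => -[x x'] [y y'] xy; congr (_, _).
- by apply: (xy K fst) => // z; exact: cvg_fst.
- by apply: (xy L snd) => // z; exact: cvg_snd.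
Qed.

Section IntervalCube.
Variable R : realType.

Lemma interval_compact_hausdorff : compact_hausdorff (interval R).
Proof. by apply: compact_hausdorff_set; [exact: segment_compact | exact: Rhausdorff]. Qed.

Lemma cube_compact_hausdorff n : compact_hausdorff (cube R n).
Proof.
apply: compact_hausdorff_set; last exact: norm_hausdorff.
apply: (@rV_compact R n (fun=> `[0, 1]%classic)) => i.
exact: segment_compact.
Qed.

(** The retraction of the line onto the unit interval; it lets paths be evaluated at real parameters
    without carrying bounds. *)
Definition clamp (r : R) : R := Order.max 0 (Order.min r 1).

Lemma clamp_interval r : interval R (clamp r).
Proof.
by rewrite /interval /= in_itv /= /clamp le_max lexx /= ge_max ler01 ge_min lexx orbT.
Qed.

Definition to_interval (r : R) : interval R := exist _ (clamp r) (mem_set (clamp_interval r)).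

Lemma to_interval_continuous : continuous to_interval.
Proof.
apply: continuous_set_type => r /=.
apply: (@continuous_max R R (cst 0) (fun r => Order.min r 1)).
  exact: cvg_cst.
apply: (@continuous_min R R idfun (cst 1)); first by move=> A.
exact: cvg_cst.
Qed.

Lemma interval_itv (t : interval R) : 0 <= \val t <= 1.
Proof. by have := set_valP t; rewrite /interval /= in_itv. Qed.

Lemma to_intervalE (r : R) : 0 <= r <= 1 -> \val (to_interval r) = r.
Proof. by move=> /andP[r0 r1]; rewrite /= /clamp min_l // max_r. Qed.

Lemma to_intervalK (t : interval R) : to_interval (\val t) = t.
Proof. by apply: val_inj; rewrite to_intervalE // interval_itv. Qed.

Lemma to_interval_le0 (r : R) : r <= 0 -> to_interval r = interval0 R.
Proof.
move=> r0; apply: val_inj => /=; rewrite /clamp max_l //.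
by rewrite ge_min r0.
Qed.

Lemma to_interval_ge1 (r : R) : 1 <= r -> to_interval r = interval1 R.
Proof. by move=> r1; apply: val_inj => /=; rewrite /clamp min_r // max_r. Qed.

(** The line is connected and retracts onto the interval, while connected subsets of a discrete
    space are points. *)
Lemma interval_discrete_constant (T : discreteTopologicalType)
    (g : interval R -> T) : continuous g -> forall s t, g s = g t.
Proof.
move=> cg s t.
have cR : connected (range (g \o to_interval)).
  apply: connected_continuous_connected; last first.
    apply: continuous_subspaceT.
    exact: (continuous_compose to_interval_continuous cg).
  by apply/connected_intervalP.
have td := zero_dimension_totally_disconnected (@discrete_zero_dimension T).
have gt : range (g \o to_interval) (g t).
  by exists (\val t) => //=; rewrite to_intervalK.
have : connected_component [set: T] (g t) (g s).
  exists (range (g \o to_interval)); first by split.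
  by exists (\val s) => //=; rewrite to_intervalK.
by rewrite td.
Qed.

End IntervalCube.

(** Off the zero set of [phi] one branch is selected on a whole neighbourhood; on it both branches
    are near the common value. *)
Lemma continuous_if (R : realType) (X Y : topologicalType) (f g : X -> Y)
    (phi : X -> R) : continuous f -> continuous g -> continuous phi ->
  (forall x, phi x = 0 -> f x = g x) ->
  continuous (fun x => if phi x <= 0 then f x else g x).
Proof.
move=> cf cg cphi fg x; case: (ltrgtP (phi x) 0) => phix A /=.
- rewrite ltW // => fA; have pN := cphi x _ (open_lt phix).
  apply: (@filterS2 _ (nbhs x) _ _ _ _ _ (cf x _ fA) pN) => y Ay /= py.
  by rewrite ltW.
- rewrite leNgt phix /= => gA; have pN := cphi x _ (open_gt phix).
  apply: (@filterS2 _ (nbhs x) _ _ _ _ _ (cg x _ gA) pN) => y Ay /= py.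
  by rewrite leNgt py.
- rewrite phix lexx => fA; have gA : nbhs (g x) A by rewrite -fg.
  apply: (@filterS2 _ (nbhs x) _ _ _ _ _ (cf x _ fA) (cg x _ gA)) => y fy gy /=.
  by case: ifP.
Qed.

(** * Mapping path spaces *)

Lemma k_open_open (X : topologicalType) (A : set X) : open A -> k_open A.
Proof. by move=> oA K u _; apply: open_comp => // x _; exact: cts_fun. Qed.

Lemma compact_hausdorff_k_space (K : topologicalType) :
  compact_hausdorff K -> k_space K.
Proof. by move=> cK A /(_ K idfun cK). Qed.

Lemma unkify_continuous (X : topologicalType) :
  continuous (fun x : kification X => x : X).
Proof. by apply/continuousP => A /k_open_open. Qed.

Lemma kify_continuous (X Y : topologicalType) (f : X -> Y) :
  k_space X -> continuous f -> continuous (f : X -> kification Y).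
Proof.
move=> kX cf; apply/continuousP => A oA; apply: kX => K u cK.
by apply: (oA K (mkcts (continuous_compose (@cts_fun _ _ u) cf)) cK).
Qed.

Lemma continuous_from_kification (X Y : topologicalType) (f : kification X -> Y) :
  (forall (K : topologicalType) (u : continuousType K X),
     compact_hausdorff K -> continuous (fun k => f (u k))) ->
  continuous f.
Proof.
move=> cf; apply/continuousP => A oA; change (@k_open X (f @^-1` A)) => K u cK.
by have /continuousP/(_ A oA) := cf K u cK.
Qed.

(** Compact Hausdorff spaces are k-spaces, so every probe of [X] is also a probe of its
    k-ification. *)
Lemma kification_k_space (X : topologicalType) : k_space (kification X).
Proof.
move=> A oA; change (@k_open X A) => K u cK.
apply: (oA K (mkcts (kify_continuous _ (@cts_fun _ _ u))) cK).
exact: compact_hausdorff_k_space.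
Qed.

(** Seen through a probe [v], the range of [u] is the projection of the coincidence set of [v] and
    [u]. That set is closed because the separating maps take values in weak Hausdorff spaces, and
    hence compact. *)
Lemma kification_weak_hausdorff (X : topologicalType) :
  (forall x y : X, (forall (Z : cgspace) (f : X -> Z), continuous f -> f x = f y) ->
     x = y) ->
  weak_hausdorff (kification X).
Proof.
move=> sep K u cK; rewrite -[range u]setCK closedC.
change (@k_open X (~` range u)) => L v cL.
rewrite preimage_setC openC.
change (closed (fun l => range u (v l))).
pose D := [set lk : L * K | (v lk.1 : X) = u lk.2].
have clD : closed D.
  rewrite -openC openE => -[l k] /= vu.
  have [Z [f [cf fvu]]] : exists (Z : cgspace) (f : X -> Z),
      continuous f /\ f (v l) <> f (u k).
    apply: contrapT => h; apply: vu; apply: sep => Z f cf.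
    by apply: contrapT => fvu; apply: h; exists Z, f.
  have cu : continuous (fun k => f (u k)).
    apply: (continuous_compose _ cf).
    exact: (continuous_compose (@cts_fun _ _ u) (@unkify_continuous X)).
  have cv := continuous_compose (@cts_fun _ _ v) cf.
  have := @weak_hausdorff_eq_closed Z L K (mkcts cv) (mkcts cu)
    (@cg_weak_hausdorff Z) cL.
  rewrite -openC => oN.
  have nN : open_nbhs (l, k) (~` [set kl : L * K | f (v kl.1) = f (u kl.2)]) by split.
  apply: (@filterS _ (nbhs (l, k)) _ _ _ _ (open_nbhs_nbhs nN)).
  by move=> -[l' k'] /= nE vu'; apply: nE; rewrite /mkcts vu'.
have <- : fst @` D = (fun l => range u (v l)).
  apply/seteqP; split=> [_ [[l k] vu <-]|l [k _ uk]]; first by exists k.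
  by exists (l, k).
apply: compact_closed; first exact: cL.2.
apply: continuous_compact.
  by apply: continuous_subspaceT => x; exact: cvg_fst.
by apply: (subclosed_compact clD (compact_setX cL.1 cK.1)) => -[].
Qed.

Section MappingPath.
Import ArrowAsCompactOpen.
Variables (R : realType) (X Y : cgspace) (j : continuousType X Y).

(** The compact-open topology is carried by all functions, whence the continuity condition. The
    k-ification of this set is the mapping path space of [j]. *)
Definition mapping_path_set : set (X * {compact-open, interval R -> Y}) :=
  [set p | continuous (p.2 : interval R -> Y) /\ p.2 (interval0 R) = j p.1].

Definition path_origin (p : kification mapping_path_set) : X := (\val p).1.

Definition path_eval (pt : kification mapping_path_set * interval R) : Y :=
  (\val pt.1).2 pt.2.

Lemma path_eval0 p : path_eval (p, interval0 R) = j (path_origin p).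
Proof. by have [] := set_valP p. Qed.

Lemma path_origin_continuous_raw :
  continuous (fun p : mapping_path_set => (\val p).1).
Proof.
apply: (continuous_compose (@set_val_continuous _ mapping_path_set)).
by move=> x; exact: cvg_fst.
Qed.

(** The interval is locally compact Hausdorff, so evaluation is jointly continuous for the
    compact-open topology. *)
Lemma path_eval_continuous_raw :
  continuous (fun pt : mapping_path_set * interval R => (\val pt.1).2 pt.2).
Proof.
have [cI hI] := interval_compact_hausdorff R.
have lcI : locally_compact [set: interval R].
  move=> x _; exists setT; first by rewrite withinET; exact: filterT.
  by split=> //; exact: closedT.
rewrite (_ : (fun pt => _) = uncurry (fun p : mapping_path_set =>
  (\val p).2 : interval R -> Y)); last by apply/funext => -[].
apply: (@continuous_uncurry mapping_path_set (interval R) Y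
  (fun p => (\val p).2 : interval R -> Y) lcI hI); last by move=> p; have [] := set_valP p.
apply: (continuous_compose (@set_val_continuous _ mapping_path_set)).
by move=> x; exact: cvg_snd.
Qed.

Lemma path_origin_continuous : continuous path_origin.
Proof.
exact: (continuous_compose (@unkify_continuous _) path_origin_continuous_raw).
Qed.

Lemma path_eval_continuous : continuous path_eval.
Proof.
have cp : continuous (fun pt : kification mapping_path_set * interval R =>
    ((pt.1 : mapping_path_set), pt.2)).
  apply: continuous_pair; last by move=> x; exact: cvg_snd.
  by apply: (continuous_compose _ (@unkify_continuous mapping_path_set)) => x;
    exact: cvg_fst.
exact: (continuous_compose cp path_eval_continuous_raw).
Qed.

Lemma mapping_path_ext (p q : kification mapping_path_set) :
  path_origin p = path_origin q -> (forall t, path_eval (p, t) = path_eval (q, t)) ->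
  p = q.
Proof.
move=> pq0 pq; apply: val_inj; move: pq0 pq; rewrite /path_origin /path_eval /=.
by case: (\val p) (\val q) => [x g] [y h] /= -> /funext ->.
Qed.

(** The origin and the evaluations are continuous maps to compactly generated spaces, and together
    they separate points. *)
Lemma mapping_path_weak_hausdorff : weak_hausdorff (kification mapping_path_set).
Proof.
apply: kification_weak_hausdorff => p q pq; apply: mapping_path_ext => [|t].
  exact: (pq X _ path_origin_continuous_raw).
apply: (pq Y (fun p => (\val p).2 t)).
apply: (continuous_compose _ path_eval_continuous_raw (f := fun p => (p, t))).
apply: continuous_pair; first by move=> x A.
exact: cst_continuous.
Qed.

Definition mapping_path : cgspace :=
  CGSpace mapping_path_weak_hausdorff (@kification_k_space mapping_path_set).

(** Currying gives continuity for the compact-open topology, and a k-space source lifts it to the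
    k-ification. *)
Lemma mapping_path_continuous (Z : topologicalType) (f : Z -> mapping_path) :
  k_space Z -> continuous (fun z => path_origin (f z)) ->
  continuous (fun zt : Z * interval R => path_eval (f zt.1, zt.2)) ->
  continuous f.
Proof.
move=> kZ c0 c1; apply: (@kify_continuous Z mapping_path_set) => //.
apply: continuous_set_type.
rewrite (_ : (fun z => _) = fun z => (path_origin (f z), (\val (f z)).2)); last first.
  by apply/funext => z; rewrite -surjective_pairing.
apply: (continuous_pair c0).
exact: (continuous_curry c1).1.
Qed.

End MappingPath.

Lemma k_space_prod_interval (R : realType) (K : topologicalType) :
  compact_hausdorff K -> k_space (K * interval R)%type.
Proof.
move=> cK; apply/compact_hausdorff_k_space/compact_hausdorff_prod => //.
exact: interval_compact_hausdorff.
Qed.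

Section MappingPathTheory.
Variables (R : realType) (X Y : cgspace) (j : continuousType X Y).

Definition mapping_point (x : X) (g : interval R -> Y) (cg : continuous g)
    (e : g (interval0 R) = j x) : mapping_path R j :=
  exist _ (x, g) (mem_set (conj cg e : mapping_path_set (R := R) j (x, g))).

Lemma path_eval_point x g cg e t : path_eval (@mapping_point x g cg e, t) = g t.
Proof. by []. Qed.

Lemma path_eval_continuousl t :
  continuous (fun p : mapping_path R j => path_eval (p, t)).
Proof.
apply: (@continuous_compose _ _ _ (fun p : mapping_path R j => (p, t)) (@path_eval R X Y j));
  last exact: path_eval_continuous.
by apply: continuous_pair; [move=> x A | exact: cst_continuous].
Qed.

Definition path_at t : continuousType (mapping_path R j) Y :=
  mkcts (@path_eval_continuousl t).

Lemma path_at_fibration : serre_fibration R (path_at (interval1 R)).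
Proof.
move=> n a h ah.
(* The lifted path at time [s] follows the path [a u], then [h (u, -)] up to [s],
   at speed [1 + s]. *)
pose T := ((cube R n * interval R) * interval R)%type.
pose r (ust : T) : R := \val ust.2 * (1 + \val ust.1.2).
have cr : continuous r.
  move=> x; apply: (@continuousM R T (fun ust => \val ust.2)
    (fun ust => 1 + \val ust.1.2)).
    apply: (@continuous_compose T _ _ snd \val) => [y|]; first exact: cvg_snd.
    exact: set_val_continuous.
  apply: (@continuousD R R T (cst 1) (fun ust : T => \val ust.1.2)).
    exact: cvg_cst.
  apply: (@continuous_compose T _ _ (fun ust => ust.1.2) \val) => [|y].
    by apply: (@continuous_compose T _ _ fst snd) => y; [exact: cvg_fst|exact: cvg_snd].
  exact: set_val_continuous.
have cr1 : continuous (fun ust => r ust - 1).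
  move=> x; apply: (@continuousB R R T r (cst 1)); first exact: cr.
  exact: cvg_cst.
have cu : continuous (fun ust : T => ust.1.1).
  by apply: (@continuous_compose T _ _ fst fst) => y; exact: cvg_fst.
pose ext (ust : T) : Y := if r ust - 1 <= 0
  then path_eval (a ust.1.1, to_interval (r ust))
  else h (ust.1.1, to_interval (r ust - 1)).
have cext : continuous ext.
  apply: continuous_if => // [||ust /eqP].
  - apply: (@continuous_compose T _ _
      (fun ust => (a ust.1.1, to_interval (r ust))) (@path_eval R X Y j));
      last exact: path_eval_continuous.
    apply: continuous_pair.
      by apply: (continuous_compose cu); exact: cts_fun.
    exact: (continuous_compose cr (@to_interval_continuous R)).
  - apply: (@continuous_compose T _ _
      (fun ust => (ust.1.1, to_interval (r ust - 1))) h); last exact: cts_fun.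
    apply: (continuous_pair cu).
    exact: (continuous_compose cr1 (@to_interval_continuous R)).
  - rewrite subr_eq0 => /eqP ->.
    by rewrite subrr to_interval_ge1 // to_interval_le0 // ah.
have cextr us : continuous (fun t => ext (us, t)).
  apply: (@continuous_compose _ _ _ (fun t => (us, t)) ext); last exact: cext.
  by apply: continuous_pair; [exact: cst_continuous | move=> x A].
have ext0 us : ext (us, interval0 R) = j (path_origin (a us.1)).
  rewrite /ext /r /= mul0r sub0r oppr_le0 ler01 to_interval_le0 //.
  exact: path_eval0.
pose l us : mapping_path R j := mapping_point (cextr us) (ext0 us).
have cl : continuous l.
  apply: mapping_path_continuous.
  - exact/k_space_prod_interval/cube_compact_hausdorff.
  - apply: (continuous_compose _ (@path_origin_continuous R X Y j)
      (f := fun us : cube R n * interval R => a us.1)).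
    by apply: (continuous_compose _ (@cts_fun _ _ a)) => y; exact: cvg_fst.
  - rewrite (_ : (fun zt => _) = ext); first exact: cext.
    by apply/funext => -[us t].
exists (mkcts cl); split=> [u|[u s]]; rewrite /mkcts.
  apply: mapping_path_ext => // t; rewrite path_eval_point /ext /r /=.
  rewrite addr0 mulr1 subr_le0 to_intervalK.
  by have /andP[_ ->] := interval_itv t.
rewrite /= /path_at /mkcts path_eval_point /ext /r /= mul1r addrAC subrr add0r.
have /andP[s0 s1] := interval_itv s.
(* At the end of the lifted path the parameter is [1 + s], past the path [a u] unless [s] is zero,
   where [a u] ends at the start of [h (u, -)]. *)
case: ifPn => [s0'|_]; last by rewrite to_intervalK.
have -> : s = interval0 R by apply: val_inj; apply/eqP; rewrite eq_le s0' s0.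
by rewrite ah to_interval_ge1 //= addr0.
Qed.

End MappingPathTheory.

(** * Mapping path flows *)

(** A k-space source lifts the pairing of [f] and [g] to the k-ified space of composable pairs,
    where composition is continuous. *)
Lemma star_continuous_comp (X : flow) (Z : topologicalType) (f g : Z -> paths X)
    (e : forall z, tgt X (f z) = src X (g z)) :
  k_space Z -> continuous f -> continuous g -> continuous (fun z => star (e z)).
Proof.
move=> kZ cf cg.
pose c z : composable (src X) (tgt X) :=
  exist _ (f z, g z) (mem_set (e z : composable (src X) (tgt X) (f z, g z))).
have cc : continuous (c : Z -> kification (composable (src X) (tgt X))).
  by apply: (kify_continuous kZ); apply: continuous_set_type; exact: continuous_pair.
rewrite (_ : (fun z => _) = fun z => star (set_valP (c z))).
  exact: (continuous_compose cc (@star_continuous X)).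
by apply/funext => z; apply: star_eq.
Qed.

Section MappingPathFlow.
Variables (R : realType) (A W : flow) (j : flow_hom A W).

Let E : cgspace := mapping_path R (on_paths j).

(** States are discrete, so the source is constant along the path and can be read off at time
    zero. *)
Lemma path_eval_src (p : E) t :
  src W (path_eval (p, t)) = on_states j (src A (path_origin p)).
Proof.
rewrite -hom_src -path_eval0.
have c : continuous (fun t => src W (path_eval (p, t))).
  apply: (continuous_compose (f := fun t => path_eval (p, t))); last exact: cts_fun.
  by have [] := set_valP p.
exact: (interval_discrete_constant c).
Qed.

Lemma path_eval_tgt (p : E) t :
  tgt W (path_eval (p, t)) = on_states j (tgt A (path_origin p)).
Proof.
rewrite -hom_tgt -path_eval0.
have c : continuous (fun t => tgt W (path_eval (p, t))).
  apply: (continuous_compose (f := fun t => path_eval (p, t))); last exact: cts_fun.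
  by have [] := set_valP p.
exact: (interval_discrete_constant c).
Qed.

Lemma mapping_path_src_continuous :
  continuous (fun p : E => src A (path_origin p)).
Proof.
apply: (continuous_compose (f := @path_origin R _ _ (on_paths j))).
  exact: path_origin_continuous.
exact: cts_fun.
Qed.

Lemma mapping_path_tgt_continuous :
  continuous (fun p : E => tgt A (path_origin p)).
Proof.
apply: (continuous_compose (f := @path_origin R _ _ (on_paths j))).
  exact: path_origin_continuous.
exact: cts_fun.
Qed.

Section Star.
Variables (p q : E) (e : tgt A (path_origin p) = src A (path_origin q)).

Lemma path_eval_composable t :
  tgt W (path_eval (p, t)) = src W (path_eval (q, t)).
Proof. by rewrite path_eval_tgt path_eval_src e. Qed.

Lemma mapping_path_star_continuous :
  continuous (fun t => star (path_eval_composable t)).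
Proof.
apply: star_continuous_comp.
- exact/compact_hausdorff_k_space/interval_compact_hausdorff.
- by have [] := set_valP p.
- by have [] := set_valP q.
Qed.

Lemma mapping_path_star0 :
  star (path_eval_composable (interval0 R)) = on_paths j (star e).
Proof.
have e' : tgt W (on_paths j (path_origin p)) = src W (on_paths j (path_origin q)).
  by rewrite hom_tgt hom_src e.
by rewrite (hom_star e e'); apply: star_eq; exact: path_eval0.
Qed.

Definition mapping_path_star : E :=
  mapping_point mapping_path_star_continuous mapping_path_star0.

End Star.

Definition mapping_path_flow : flow.
Proof.
refine (@Flow (states A) E (mkcts mapping_path_src_continuous)
  (mkcts mapping_path_tgt_continuous) mapping_path_star _ _ _ _).
(* Composition acts on origins and at each time separately. Continuity is tested on compact
   Hausdorff probes, whose products with the interval are k-spaces. *)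
- apply: continuous_from_kification => K u cK.
  have cfst : continuous (fun k => (\val (u k)).1).
    apply: (continuous_compose (f := fun k => \val (u k))); last by move=> x; exact: cvg_fst.
    exact: (continuous_compose (@cts_fun _ _ u) (@set_val_continuous _ _)).
  have csnd : continuous (fun k => (\val (u k)).2).
    apply: (continuous_compose (f := fun k => \val (u k))); last by move=> x; exact: cvg_snd.
    exact: (continuous_compose (@cts_fun _ _ u) (@set_val_continuous _ _)).
  apply: mapping_path_continuous.
  + exact: compact_hausdorff_k_space.
  + apply: star_continuous_comp.
    * exact: compact_hausdorff_k_space.
    * exact: (continuous_compose cfst (@path_origin_continuous R _ _ (on_paths j))).
    * exact: (continuous_compose csnd (@path_origin_continuous R _ _ (on_paths j))).
  + have ceval (f : K -> E) : continuous f ->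
        continuous (fun kt : K * interval R => path_eval (f kt.1, kt.2)).
      move=> cf; apply: (continuous_compose (f := fun kt : K * interval R => (f kt.1, kt.2)));
        last exact: path_eval_continuous.
      apply: continuous_pair; last by move=> x; exact: cvg_snd.
      by apply: (continuous_compose _ cf) => x; exact: cvg_fst.
    apply: star_continuous_comp.
    * exact: k_space_prod_interval.
    * exact: (ceval _ cfst).
    * exact: (ceval _ csnd).
- by move=> x y e; exact: src_star.
- by move=> x y e; exact: tgt_star.
- move=> x y z exy eyz exyz exyz'; apply: mapping_path_ext => [|t].
    exact: starA.
  exact: starA.
Defined.

Definition path_hom (t : interval R) : flow_hom mapping_path_flow W.
Proof.
refine (@FlowHom mapping_path_flow W (on_states j) (path_at (on_paths j) t) _ _ _).
- by move=> p; exact: path_eval_src.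
- by move=> p; exact: path_eval_tgt.
- by move=> p q e e'; apply: star_eq.
Defined.

Definition origin_hom : flow_hom mapping_path_flow A.
Proof.
refine (@FlowHom mapping_path_flow A idfun
  (mkcts (@path_origin_continuous R _ _ (on_paths j))) _ _ _) => //.
by move=> p q e e'; apply: star_eq.
Defined.

Lemma constant_path_continuous : continuous (fun a : paths A =>
  mapping_point (@cst_continuous (interval R) _ (on_paths j a)) erefl : E).
Proof.
apply: mapping_path_continuous; first exact: cg_k_space.
  by move=> a U.
apply: (continuous_compose (f := fst)); last exact: cts_fun.
by move=> x; exact: cvg_fst.
Qed.

Definition constant_hom : flow_hom A mapping_path_flow.
Proof.
refine (@FlowHom A mapping_path_flow idfun (mkcts constant_path_continuous) _ _ _) => //.
move=> a b e e'; apply: mapping_path_ext => [|t]; first exact: star_eq.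
have eW : tgt W (on_paths j a) = src W (on_paths j b) by rewrite hom_tgt hom_src e.
by apply: etrans (hom_star e eW) _; exact: star_eq.
Defined.

End MappingPathFlow.

(** * S-homotopic morphisms of flows *)

(** S-homotopy of morphisms; asking for a morphism at each time makes every stage compatible with
    composition. *)
Definition flow_homotopic (R : realType) (X Y : flow) (f g : flow_hom X Y) : Prop :=
  on_states f = on_states g /\
  exists h : continuousType (paths X * interval R)%type (paths Y),
  [/\ forall x, h (x, interval0 R) = on_paths f x,
      forall x, h (x, interval1 R) = on_paths g x
    & forall t, exists k : flow_hom X Y, forall x, on_paths k x = h (x, t)].

Lemma flow_homotopic_comp (R : realType) (X' X Y Y' : flow) (u : flow_hom X' X)
    (f g : flow_hom X Y) (v : flow_hom Y Y') :
  flow_homotopic R f g ->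
  flow_homotopic R (flow_comp v (flow_comp f u)) (flow_comp v (flow_comp g u)).
Proof.
move=> [fg [h [h0 h1 hk]]]; split; first by rewrite /= fg.
have c : continuous (fun xt : paths X' * interval R =>
    on_paths v (h (on_paths u xt.1, xt.2))).
  apply: (continuous_compose (f := fun xt : paths X' * interval R =>
    h (on_paths u xt.1, xt.2))); last exact: cts_fun.
  apply: (continuous_compose (f := fun xt : paths X' * interval R =>
    (on_paths u xt.1, xt.2))); last exact: cts_fun.
  apply: continuous_pair; last by move=> x; exact: cvg_snd.
  by apply: (continuous_compose _ (@cts_fun _ _ (on_paths u))) => x; exact: cvg_fst.
exists (mkcts c); split=> [x|x|t].
- by rewrite /= -h0.
- by rewrite /= -h1.
- have [k kE] := hk t; exists (flow_comp v (flow_comp k u)) => x /=.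
  by rewrite kE.
Qed.

(* The universal property is applied to the transposed homotopy, with values in
   the space of paths in the branching space (pairs of a path and its origin):
   this avoids taking products of quotient maps. *)
Lemma branching_map_homotopic (R : realType) (X Y : flow) (f g : flow_hom X Y) :
  flow_homotopic R f g -> homotopic R (branching_map f) (branching_map g).
Proof.
move=> [_ [h [h0 h1 hk]]].
pose B : cgspace := branching_of Y; pose pr := branching_proj (branching_of Y).
pose id_B : continuousType B B := idfun.
have ch x : continuous (fun t => pr (h (x, t))).
  apply: (continuous_compose (f := fun t => h (x, t))); last exact: cts_fun.
  apply: (continuous_compose (f := fun t => (x, t))); last exact: cts_fun.
  by apply: continuous_pair; [exact: cst_continuous | move=> y U].
have e0 x : pr (h (x, interval0 R)) = id_B (pr (h (x, interval0 R))) by [].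
pose phi x : mapping_path R id_B := mapping_point (ch x) (e0 x).
have cphi : continuous phi.
  apply: mapping_path_continuous; first exact: cg_k_space.
    apply: (continuous_compose (f := fun x => h (x, interval0 R))); last exact: cts_fun.
    apply: (continuous_compose (f := fun x => (x, interval0 R))); last exact: cts_fun.
    by apply: continuous_pair; [move=> y U | exact: cst_continuous].
  apply: (continuous_compose (f := fun xt => h (xt.1, xt.2))); last exact: cts_fun.
  apply: (continuous_compose (f := fun xt => (xt.1, xt.2))); last exact: cts_fun.
  by apply: continuous_pair => x; [exact: cvg_fst | exact: cvg_snd].
have iphi : branching_invariant (mkcts cphi).
  (* Each stage of the homotopy is a morphism and so induces a map of branching spaces. *)
  have hinv x y (e : tgt X x = src X y) t : pr (h (x, t)) = pr (h (star e, t)).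
    have [k kE] := hk t; rewrite -!kE -!branching_mapE.
    by congr (branching_map _ _); exact: branching_projP.
  move=> x y e; apply: mapping_path_ext => [|t]; exact: hinv.
pose psi := branching_lift (branching_of X) iphi.
have psiE x t : path_eval (psi (branching_proj (branching_of X) x), t) = pr (h (x, t)).
  by rewrite /psi branching_liftE.
have cH : continuous (fun bt : branching_of X * interval R =>
    path_eval (psi bt.1, bt.2)).
  apply: (continuous_compose (f := fun bt : branching_of X * interval R =>
    (psi bt.1, bt.2))); last exact: path_eval_continuous.
  apply: continuous_pair; last by move=> x; exact: cvg_snd.
  by apply: (continuous_compose _ (@cts_fun _ _ psi)) => x; exact: cvg_fst.
have end_at (k : flow_hom X Y) t : (forall x, h (x, t) = on_paths k x) ->
    forall b, path_eval (psi b, t) = branching_map k b.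
  move=> hkt b.
  have ct : continuous (fun b => path_eval (psi b, t)).
    apply: (continuous_compose _ (@path_eval_continuousl R _ _ id_B t)).
    exact: cts_fun.
  apply: (@branching_ext X (branching_of X) B (mkcts ct) (branching_map k)) => x.
  by rewrite [RHS]branching_mapE -hkt; exact: psiE.
exists (mkcts cH); split=> b; exact: end_at.
Qed.

Lemma branching_map_id (X : flow) b : branching_map (flow_id X) b = b.
Proof.
apply: (@branching_ext X (branching_of X) (branching_of X) (branching_map (flow_id X)) idfun).
by move=> x /=; rewrite branching_mapE.
Qed.

Lemma branching_map_comp (X Y Z : flow) (g : flow_hom Y Z) (f : flow_hom X Y) b :
  branching_map (flow_comp g f) b = branching_map g (branching_map f b).
Proof.
apply: (@branching_ext X (branching_of X) (branching_of Z)
  (branching_map (flow_comp g f)) (branching_map g \o branching_map f)).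
by move=> x /=; rewrite !branching_mapE.
Qed.

(** * Homotopy inverses from the model structure *)

Section ModelCategory.
Variables (C : category) (M : model_structure C).

(* The identity is a retract of the right factor of its own factorization. *)
Lemma weq_id (X : C) : weq M (idm X).
Proof.
have [_ wr] := cof_tfib_right M (idm X).
apply: weq_retract wr; exists (ff_left (cof_tfib M) (idm X)).
exists (ff_right (cof_tfib M) (idm X)), (idm X), (idm X).
by rewrite !cmp1m ff_fact.
Qed.

(** Two-out-of-three, the composite being an identity and hence a weak equivalence. *)
Lemma weq_section (X Y : C) (p : hom X Y) (s : hom Y X) :
  cmp p s = idm Y -> weq M p <-> weq M s.
Proof.
move=> ps; have [_ ws_wps wp_wps] := weq_2of3 M s p.
by split=> w; [apply: wp_wps | apply: ws_wps] => //; rewrite ps; exact: weq_id.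
Qed.

End ModelCategory.

Section FlowModel.
Variables (R : realType) (M : model_structure Flow_cat).
Hypothesis hM : is_flow_model_structure R M.

Lemma trivial_cofibration_homotopy_inverse (A W : flow) (j : flow_hom A W) :
  @cof Flow_cat M A W j -> @weq Flow_cat M A W j ->
  exists r : flow_hom W A,
    flow_comp r j = flow_id A /\ flow_homotopic R (flow_comp j r) (flow_id W).
Proof.
move=> cj wj.
have fp : @fib Flow_cat M _ W (path_hom j (interval1 R)).
  by apply/(hM.2 _ _ _); exact: path_at_fibration.
(* The lifting square has the constant paths on top and the identity of [W] below; it commutes
   because a constant path ends where it starts. *)
have [l [lj pl]] : exists l : flow_hom W (mapping_path_flow R j),
    flow_comp l j = constant_hom R j /\
    flow_comp (path_hom j (interval1 R)) l = flow_id W.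
  apply: (@tcof_fib_lift Flow_cat M _ _ _ _ j _ cj wj fp (constant_hom R j) (flow_id W)).
  by apply: flow_homP.
exists (flow_comp (origin_hom R j) l); split.
  apply: flow_homP => a /=.
    by rewrite -[RHS]/(on_states (constant_hom R j) a) -lj.
  rewrite -[RHS]/(path_origin (on_paths (constant_hom R j) a)) -lj.
  by [].
(* On states every [path_hom j t] is [on_states j], so the equation at time one settles the states
   at time zero too. *)
split; first by rewrite -pl.
have c : continuous (fun wt : paths W * interval R =>
    path_eval (on_paths l wt.1, wt.2)).
  apply: (continuous_compose (f := fun wt : paths W * interval R =>
    (on_paths l wt.1, wt.2))); last exact: path_eval_continuous.
  apply: continuous_pair; last by move=> x; exact: cvg_snd.
  by apply: (continuous_compose _ (@cts_fun _ _ (on_paths l))) => x; exact: cvg_fst.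
exists (mkcts c); split=> [x|x|t]; rewrite /mkcts.
- exact: path_eval0.
- by rewrite -[RHS]/(on_paths (flow_id W) x) -pl.
- by exists (flow_comp (path_hom j t) l).
Qed.

(** The conclusion that [s] is again a weak equivalence allows a second application, to [s]
    itself. *)
Lemma weq_homotopy_inverse (A B : flow) (g : flow_hom A B) :
  @weq Flow_cat M A B g -> @cof Flow_cat M empty_flow B (empty_flow_hom B) ->
  exists s : flow_hom B A,
    @weq Flow_cat M B A s /\ flow_homotopic R (flow_comp g s) (flow_id B).
Proof.
move=> wg cB.
pose W : flow := ff_mid (tcof_fib M) g.
pose j : flow_hom A W := ff_left (tcof_fib M) g.
pose q : flow_hom W B := ff_right (tcof_fib M) g.
have gE : flow_comp q j = g by exact: (@ff_fact Flow_cat).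
have [cj wj] := @tcof_fib_left Flow_cat M A B g.
have fq := @tcof_fib_right Flow_cat M A B g.
have wq : @weq Flow_cat M W B q.
  have [_ h _] := @weq_2of3 Flow_cat M A W B j q.
  by apply: h => //; rewrite -[cmp _ _]/(flow_comp q j) gE.
have [u [_ qu]] : exists u : flow_hom B W,
    flow_comp u (empty_flow_hom B) = empty_flow_hom W /\ flow_comp q u = flow_id B.
  apply: (@cof_tfib_lift Flow_cat M _ _ _ _ (empty_flow_hom B) q cB fq wq
    (empty_flow_hom W) (flow_id B)).
  exact: (@init_uniq Flow_cat empty_flow_initial).
have [r [rj jr]] := trivial_cofibration_homotopy_inverse cj wj.
exists (flow_comp r u); split.
  have wu : @weq Flow_cat M B W u by apply/(@weq_section Flow_cat M W B q u qu).
  have wr : @weq Flow_cat M W A r by apply/(@weq_section Flow_cat M W A r j rj).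
  by have [h _ _] := @weq_2of3 Flow_cat M B W A u r; exact: h.
(* Composing the homotopy from [j r] to the identity with [u] and [q] joins [q j r u = g s] to
   [q u], the identity. *)
have := flow_homotopic_comp u q jr.
have -> : flow_comp q (flow_comp (flow_id W) u) = flow_id B.
  by rewrite -qu; exact: flow_homP.
have -> // : flow_comp q (flow_comp (flow_comp j r) u) = flow_comp g (flow_comp r u).
rewrite -[RHS](congr1 (fun k => flow_comp k (flow_comp r u)) gE).
exact: flow_homP.
Qed.

End FlowModel.

(** * The isomorphism in branching homology *)

(** Augmentations and maps of states are arbitrary here, since the homotopy inverses between
    cofibrant replacements need not come from morphisms between the original flows. *)
Lemma homology_map_cancel (R : realType) (A B : flow) (S S' : choiceType)
    (eA : branching_of A -> S) (eB : branching_of B -> S')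
    (f : flow_hom A B) (s : flow_hom B A) (F : S -> S') (G : S' -> S)
    (eF : forall b, eB (branching_map f b) = F (eA b))
    (eG : forall b, eA (branching_map s b) = G (eB b)) n :
  flow_homotopic R (flow_comp f s) (flow_id B) -> cancel G F ->
  cancel (aug_homology_map R eG n) (aug_homology_map R eF n).
Proof.
move=> fs GF u.
have e1 x : eB ((branching_map f \o branching_map s) x) = (F \o G) (eB x).
  by rewrite /= eF eG.
rewrite (aug_homology_map_comp eG eF e1).
rewrite (@aug_homology_map_homotopic _ _ _ _ _ _ _ _ idfun _ idfun e1 (fun=> erefl)) //.
  exact: aug_homology_map_id.
have [H [H0 H1]] := branching_map_homotopic fs; exists H; split=> b.
  by rewrite H0 branching_map_comp.
by rewrite H1 branching_map_id.
Qed.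

Theorem corollary6p5 (R : realType) (M : model_structure Flow_cat)
  (hM : is_flow_model_structure R M) (X Y : flow) (f : flow_hom X Y)
  (hf : weak_S_homotopy_equivalence R f) (n : nat) :
  bijective (branching_homology_map R M n f).
Proof.
have wproj (Z : flow) : @weq Flow_cat M _ Z (flow_cofrep_proj M Z).
  exact: (@cof_tfib_right Flow_cat M empty_flow Z (empty_flow_hom Z)).2.
have cQ (Z : flow) :
    @cof Flow_cat M empty_flow (flow_cofrep M Z) (empty_flow_hom (flow_cofrep M Z)).
  rewrite (@init_uniq Flow_cat empty_flow_initial _ (empty_flow_hom _)
    (ff_left (cof_tfib M) (init_map empty_flow_initial Z))).
  exact: (@cof_tfib_left Flow_cat M empty_flow Z).
have natQ : flow_comp (flow_cofrep_proj M Y) (flow_cofrep_map M f) =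
    flow_comp f (flow_cofrep_proj M X).
  exact: (@cofrep_proj_natural Flow_cat).
have wQf : @weq Flow_cat M _ _ (flow_cofrep_map M f).
  have [_ _ h] := @weq_2of3 Flow_cat M _ _ Y (flow_cofrep_map M f) (flow_cofrep_proj M Y).
  apply: h; first exact: wproj.
  rewrite -[cmp _ _]/(flow_comp _ _) natQ.
  have [h' _ _] := @weq_2of3 Flow_cat M _ _ Y (flow_cofrep_proj M X) f.
  by apply: h'; [exact: wproj | apply/(hM.1 _ _ _)].
have [s [ws fs]] := weq_homotopy_inverse hM wQf (cQ Y).
have [t [_ st]] := weq_homotopy_inverse hM ws (cQ X).
have [[k fk kf] _] := hf.
have fs0 c : on_states (flow_cofrep_map M f) (on_states s c) = c.
  by have /(congr1 (fun F => F c)) := fs.1.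
have st0 c : on_states s (on_states t c) = c.
  by have /(congr1 (fun F => F c)) := st.1.
have nat0 c : on_states (flow_cofrep_proj M Y) (on_states (flow_cofrep_map M f) c) =
    on_states f (on_states (flow_cofrep_proj M X) c).
  by have /(congr1 (fun F => on_states F c)) := natQ.
(* With the states of the replacements projected to those of [X] and [Y], [s] acts as the inverse
   [k] of [f] on states, and [t] acts as [f]. *)
have es b : @ho_branching_src M X (branching_map s b) = k (@ho_branching_src M Y b).
  rewrite /ho_branching_src branching_src_natural; apply: (can_inj fk).
  by rewrite kf -nat0 fs0.
have et b : @ho_branching_src M Y (branching_map t b) = on_states f (@ho_branching_src M X b).
  by rewrite /ho_branching_src branching_src_natural -nat0 -{2}(st0 (branching_src _ b)) fs0.
pose Hs := aug_homology_map R es n; pose Ht := aug_homology_map R et n.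
have Hfs : cancel Hs (branching_homology_map R M n f) by exact: homology_map_cancel.
have Hst : cancel Ht Hs by exact: homology_map_cancel.
(* [Hs] has the map induced by [f] as left inverse and [Ht] as right inverse; the two therefore
   coincide. *)
exists Hs => // u; rewrite -{1}(Hst u) Hfs; exact: Hst.
Qed.
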